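(* For every parameter $q=q(n)\in[n]$ there exists a data structure such that: (1) given a permutation $\pi\in\mathbb{S}_n$, it is initialised in $\widetilde{\mathcal{O}}(n^2/q)$ time; (2) given any axis-parallel rectangle $\mathcal{R}=[x_1,x_2]\times[y_1,y_2]\subseteq[n]\times[n]$, it returns the number of descending (respectively, ascending) pairs of points of $\pi$ lying in $\mathcal{R}$ in $\widetilde{\mathcal{O}}(q)$ time.
   Context: The points of $\pi$ are $p(\pi)=\{(i,\pi(i)):i\in[n]\}$; $\pi$ is given as the vector $(\pi(1),\dots,\pi(n))$. A pair of points $(i,\pi(i)),(j,\pi(j))$ with $i<j$ is ascending if $\pi(i)<\pi(j)$ and descending otherwise; it lies in $\mathcal{R}$ if both points are in $\mathcal{R}$. $\widetilde{\mathcal{O}}$ hides polylogarithmic factors in $n$. *)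

(* Defs.v *)
From mathcomp Require Import all_boot all_order all_algebra all_fingroup.
Set Implicit Arguments.
Unset Strict Implicit.
Unset Printing Implicit Defensive.

(** * Pairs of points of a permutation in a rectangle *)

Record rect := Rect { rx1 : nat; rx2 : nat; ry1 : nat; ry2 : nat }.

Definition rect_sub (n : nat) (R : rect) : bool :=
  [&& 1 <= rx1 R, rx1 R <= rx2 R, rx2 R <= n,
      1 <= ry1 R, ry1 R <= ry2 R & ry2 R <= n].

(* ['S_n] permutes {0, ..., n-1}; coordinates are shifted into {1, ..., n}. *)
Definition point (n : nat) (pi : 'S_n) (i : 'I_n) : nat * nat :=
  (i.+1, (pi i).+1).

Definition in_rect (R : rect) (p : nat * nat) : bool :=
  (rx1 R <= p.1 <= rx2 R) && (ry1 R <= p.2 <= ry2 R).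

Inductive direction := Ascending | Descending.

Definition pair_dir (d : direction) (p p' : nat * nat) : bool :=
  match d with
  | Ascending => p.2 < p'.2
  | Descending => ~~ (p.2 < p'.2)
  end.

Definition count_pairs (d : direction) (n : nat) (pi : 'S_n) (R : rect) : nat :=
  #|[set ij : 'I_n * 'I_n |
      [&& (point pi ij.1).1 < (point pi ij.2).1,
          pair_dir d (point pi ij.1) (point pi ij.2),
          in_rect R (point pi ij.1) & in_rect R (point pi ij.2)]]|.

(** * Word RAM

    Structured programs over registers and a random-access memory whose cells
    hold [w]-bit words.  Every operator application, constant, register read,
    memory read, assignment, memory write and branch costs one time unit. *)

Inductive binop := Add | Sub | Mul | Div | Mod | Lt | Eq.

Inductive expr :=
  | Const of nat
  | Reg of nat
  | Fetch of expr
  | Bin of binop & expr & expr.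

Inductive com :=
  | Skip
  | Assign of nat & expr
  | Store of expr & expr
  | Seq of com & com
  | If of expr & com & com
  | While of expr & com.

Record state := State { regs : nat -> nat; mem : nat -> nat }.

Definition upd (f : nat -> nat) (a v : nat) : nat -> nat :=
  fun b => if b == a then v else f b.

(* [Sub] truncates at 0, and [Div] by 0 returns 0. *)
Definition eval_binop (o : binop) (a b : nat) : nat :=
  match o with
  | Add => a + b
  | Sub => a - b
  | Mul => a * b
  | Div => a %/ b
  | Mod => a %% b
  | Lt => a < b
  | Eq => a == b
  end.

Fixpoint eval (w : nat) (s : state) (e : expr) : nat :=
  match e with
  | Const v => v %% 2 ^ w
  | Reg r => regs s r
  | Fetch e1 => mem s (eval w s e1)
  | Bin o e1 e2 => eval_binop o (eval w s e1) (eval w s e2) %% 2 ^ w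
  end.

Fixpoint ecost (e : expr) : nat :=
  match e with
  | Const _ | Reg _ => 1
  | Fetch e1 => (ecost e1).+1
  | Bin _ e1 e2 => (ecost e1 + ecost e2).+1
  end.

(* [exec w c s t s']: with word size [w], [c] started in [s] halts in [s']
   after [t] time units. *)
Inductive exec (w : nat) : com -> state -> nat -> state -> Prop :=
  | ExecSkip s : exec w Skip s 1 s
  | ExecAssign r e s :
      exec w (Assign r e) s (ecost e).+1
        (State (upd (regs s) r (eval w s e)) (mem s))
  | ExecStore e1 e2 s :
      exec w (Store e1 e2) s (ecost e1 + ecost e2).+1
        (State (regs s) (upd (mem s) (eval w s e1) (eval w s e2)))
  | ExecSeq c1 c2 s1 s2 s3 t1 t2 :
      exec w c1 s1 t1 s2 -> exec w c2 s2 t2 s3 ->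
      exec w (Seq c1 c2) s1 (t1 + t2) s3
  | ExecIfTrue e c1 c2 s s' t :
      eval w s e != 0 -> exec w c1 s t s' ->
      exec w (If e c1 c2) s ((ecost e).+1 + t) s'
  | ExecIfFalse e c1 c2 s s' t :
      eval w s e = 0 -> exec w c2 s t s' ->
      exec w (If e c1 c2) s ((ecost e).+1 + t) s'
  | ExecWhileFalse e c s :
      eval w s e = 0 -> exec w (While e c) s (ecost e).+1 s
  | ExecWhileTrue e c s1 s2 s3 t1 t2 :
      eval w s1 e != 0 -> exec w c s1 t1 s2 -> exec w (While e c) s2 t2 s3 ->
      exec w (While e c) s1 ((ecost e).+1 + t1 + t2) s3.

Lemma exec_det w c s t1 s1 t2 s2 :
  exec w c s t1 s1 -> exec w c s t2 s2 -> t1 = t2 /\ s1 = s2.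
Proof.
move=> H; elim: H t2 s2 => {c s t1 s1}.
- by move=> s t2 s2 H; inversion H.
- by move=> r e s t2 s2 H; inversion H.
- by move=> e1 e2 s t2 s2 H; inversion H.
- move=> c1 c2 s1 s2 s3 t1 t2 _ IH1 _ IH2 t s H.
  inversion H as [| | |? ? ? s2' ? t1' t2' E1 E2| | | |]; subst.
  by have [? ?] := IH1 _ _ E1; subst; have [? ?] := IH2 _ _ E2; subst.
- move=> e c1 c2 s s' t hne _ IH t2 s2 H.
  inversion H as [| | | |? ? ? ? ? ? h E|? ? ? ? ? ? h E| |]; subst.
    by have [? ?] := IH _ _ E; subst.
  by rewrite h in hne.
- move=> e c1 c2 s s' t he _ IH t2 s2 H.
  inversion H as [| | | |? ? ? ? ? ? h E|? ? ? ? ? ? h E| |]; subst.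
    by rewrite he in h.
  by have [? ?] := IH _ _ E; subst.
- move=> e c s he t2 s2 H.
  by inversion H as [| | | | | | |? ? ? ? ? ? ? h]; subst => //; rewrite he in h.
- move=> e c s1 s2 s3 t1 t2 hne _ IH1 _ IH2 t s H.
  inversion H as [| | | | | |? ? ? h|? ? ? ? ? ? ? h E1 E2]; subst.
    by rewrite h in hne.
  by have [? ?] := IH1 _ _ E1; subst; have [? ?] := IH2 _ _ E2; subst.
Qed.

(** * Data structures *)

(* [ds_word] is the constant in the word size, which is Theta(log n). *)
Record data_structure := DataStructure {
  ds_word : nat;
  ds_word_gt0 : 0 < ds_word;
  ds_init : com;
  ds_query : direction -> com
}.

Definition word_size (D : data_structure) (n : nat) : nat :=
  ds_word D * (trunc_log 2 n).+1.

Definition args (s : seq nat) : nat -> nat := fun r => nth 0 s r.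

(* The cells 1, ..., n hold pi(1), ..., pi(n); all other cells hold 0. *)
Definition input_mem (n : nat) (pi : 'S_n) : nat -> nat :=
  fun a => if a is i.+1 then
             if insub i is Some j then (pi (j : 'I_n)).+1 else 0
           else 0.

(* The parameter is an input word: no computability of [q] is assumed. *)
Definition run_init (D : data_structure) (n q : nat) (pi : 'S_n)
    (t : nat) (s : state) : Prop :=
  exec (word_size D n) (ds_init D) (State (args [:: n; q]) (input_mem pi)) t s.

Definition run_query (D : data_structure) (n : nat) (d : direction) (R : rect)
    (m : nat -> nat) (t : nat) (s : state) : Prop :=
  exec (word_size D n) (ds_query D d)
    (State (args [:: rx1 R; rx2 R; ry1 R; ry2 R]) m) t s.

(* Queries may write to memory, so a query has to be answered correctly in every
   memory left by the initialisation and any earlier queries. *)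
Inductive reachable (D : data_structure) (n q : nat) (pi : 'S_n) :
    (nat -> nat) -> Prop :=
  | AfterInit t s : run_init D q pi t s -> reachable D q pi (mem s)
  | AfterQuery d R m t s :
      reachable D q pi m -> rect_sub n R -> run_query D n d R m t s ->
      reachable D q pi (mem s).

Definition output (s : state) : nat := regs s 0.

(** * Soft-O *)

(* For n >= 2, [trunc_log 2 n] is within a factor 2 of log_2 n. *)
Definition softO (f : nat -> nat) (g : nat -> rat) : Prop :=
  exists C k n0 : nat, forall n : nat, n0 <= n ->
    ((f n)%:R <= C%:R * g n * (trunc_log 2 n)%:R ^+ k :> rat)%R.

(* Main.v *)
From mathcomp Require Import all_boot all_order all_algebra all_fingroup.
From mathcomp Require Import zify.
Require Import Defs.
Set Implicit Arguments.
Unset Strict Implicit.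
Unset Printing Implicit Defensive.

(** Shift the points to [0, n) x [0, n).  In a descending pair (i, j) the point i is
    the upper left one, so inclusion-exclusion over the four sides of the rectangle
    expresses the count by products of point counts, by the number of descending
    pairs in a corner [0, x) x [0, y), and by the numbers F(x1, x2, y) of descending
    pairs with i < x1 <= j < x2 and pi(i) < y, for pi and for its inverse.
    - Points in a rectangle are counted in polylogarithmic time from the populations
      of the dyadic cells.
    - The corner counts are stored for x a multiple of q and all y; fewer than q
      columns are then added one at a time.
    - For F, the ordinates below y are cut into dyadic strips. Points in different
      strips contribute products, since the abscissa x1 separates i from j. Within
      a strip, indexing abscissas by rank among the points of the strip, the counts
      are stored for the first rank a multiple of q and the second one arbitrary;
      this takes n^2/q cells per level, and fewer than q strip points are then
      moved across the separating abscissa.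
    The number of ascending pairs is the number of all pairs minus that of the
    descending ones. *)

(** * A program logic for the word RAM *)

(** The obstacle is F: it has three free arguments, and rounding one of them to multiples of [q]
    would still leave about n^3/q cells. Inside a strip the two abscissas matter only through their
    ranks, and the populations of the strips of one level add up to at most n. So n/q rounded first
    ranks against all second ranks cost about n^2/q cells for a whole level, and there are only
    logarithmically many levels. A table must also be filled within this bound. Every count
    therefore has a recurrence whose increment is a single point count: adding a column, raising the
    upper ordinate by one, or passing to the next rank. The same recurrences drive the walks of a
    query. Subtraction truncates at 0, so the identities are mostly stated with sums on both sides,
    and the programs collect positive and negative terms separately before one final subtraction.
    The query programs work in registers only. As execution is deterministic, earlier queries leave
    the memory exactly as the initialisation left it. *)

(* A stack [G] lists the contents of the registers [size G - 1, ..., 0]. *)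
Fixpoint fits (G : seq nat) (s : state) : Prop :=
  if G is v :: G' then regs s (size G') = v /\ fits G' s else True.

(** Only the memory and the stack are constrained, so the registers above the stack are free scratch
    space and may hold anything. *)
Definition denotes w m G e v :=
  forall s, mem s = m -> fits G s -> eval w s e = v.

(* The result is left in the first register above the stack. *)
Definition computes w m G c v T :=
  forall s, mem s = m -> fits G s ->
  exists t s', [/\ exec w c s t s', t <= T, mem s' = m, fits G s'
                 & regs s' (size G) = v].

Definition runs w m G c (Q : (nat -> nat) -> Prop) T :=
  forall s, mem s = m -> fits G s ->
  exists t s', [/\ exec w c s t s', t <= T, fits G s' & Q (mem s')].

(** A local variable: [c1] leaves its value in register [d], where [c2] finds it on top of the
    stack. The last assignment moves the result of [c2] down onto it, which pops the variable. *)
Definition bind d c1 c2 := Seq c1 (Seq c2 (Assign d (Reg d.+1))).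

(** Register [d] accumulates and [d.+1] counts. As [body] runs above both, its result appears in
    [d.+2] and is copied back. *)
Definition iterate d eb e0 body :=
  Seq (Assign d e0) (Seq (Assign d.+1 (Const 0))
    (While (Bin Lt (Reg d.+1) eb)
       (Seq body (Seq (Assign d (Reg d.+2))
          (Assign d.+1 (Bin Add (Reg d.+1) (Const 1))))))).

Definition summation d eb body :=
  iterate d eb (Const 0)
    (bind d.+2 body (Assign d.+3 (Bin Add (Reg d) (Reg d.+2)))).

Definition for_loop d eb body :=
  Seq (Assign d (Const 0))
    (While (Bin Lt (Reg d) eb)
       (Seq body (Assign d (Bin Add (Reg d) (Const 1))))).

(** The 300 absorbs a guard test, the bookkeeping of a round and the set-up of the loop, for guards
    and initial values of cost at most 100. The extra round in [b.+1] pays for the last, failing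
    test. *)
Definition loopT b Tb := b.+1 * (Tb + 300).
Definition sumT b Tb := loopT b (Tb + 20).

Section Logic.
Variables (w : nat) (m : nat -> nat).
Implicit Types (G : seq nat) (e : expr) (c : com) (v T : nat).

Lemma fits_regs G s s' :
  (forall r, r < size G -> regs s' r = regs s r) -> fits G s -> fits G s'.
Proof.
elim: G => [|v G IH] //= h [h1 h2]; split; first by rewrite h.
by apply: IH => // r hr; apply: h; apply: leq_trans hr _.
Qed.

Lemma fits_upd G s r v m' :
  size G <= r -> fits G s -> fits G (State (upd (regs s) r v) m').
Proof.
move=> h; apply: fits_regs => k hk /=; rewrite /upd; case: eqP => // E.
by move: hk; rewrite E ltnNge h.
Qed.

Lemma upd_same f a v : upd f a v a = v. Proof. by rewrite /upd eqxx. Qed.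

Lemma upd_other f a v b : b != a -> upd f a v b = f b.
Proof. by rewrite /upd => /negbTE ->. Qed.

Lemma denotes_top G v : denotes w m (v :: G) (Reg (size G)) v.
Proof. by move=> s _ [h _]. Qed.

Lemma denotes_weaken G x e v : denotes w m G e v -> denotes w m (x :: G) e v.
Proof. by move=> h s hm [_ hf]; apply: h. Qed.

Lemma denotes_const G v : v < 2 ^ w -> denotes w m G (Const v) v.
Proof. by move=> h s _ _ /=; rewrite modn_small. Qed.

Lemma denotes_fetch G e a : denotes w m G e a -> denotes w m G (Fetch e) (m a).
Proof. by move=> h s hm hf /=; rewrite (h s) // hm. Qed.

Lemma denotes_bin o G e1 e2 a b :
  denotes w m G e1 a -> denotes w m G e2 b -> eval_binop o a b < 2 ^ w ->
  denotes w m G (Bin o e1 e2) (eval_binop o a b).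
Proof. by move=> h1 h2 h s hm hf /=; rewrite (h1 s) // (h2 s) // modn_small. Qed.

Lemma denotes_eq G e v v' : denotes w m G e v -> v = v' -> denotes w m G e v'.
Proof. by move=> h <-. Qed.

Lemma computes_eq G c v T v' T' :
  computes w m G c v T -> v = v' -> T <= T' -> computes w m G c v' T'.
Proof.
move=> h <- hT s hm hf; have [t [s' [h1 h2 h3 h4 h5]]] := h s hm hf.
by exists t, s'; split => //; apply: leq_trans hT.
Qed.

Lemma computes_expr G e v T :
  denotes w m G e v -> ecost e < T -> computes w m G (Assign (size G) e) v T.
Proof.
move=> h hT s hm hf; eexists _, _; split; first exact: ExecAssign.
- exact: hT.
- by [].
- exact: fits_upd.
- by rewrite /= upd_same h.
Qed.

Lemma computes_bind G c1 c2 v1 v2 T1 T2 :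
  computes w m G c1 v1 T1 -> computes w m (v1 :: G) c2 v2 T2 ->
  computes w m G (bind (size G) c1 c2) v2 (T1 + T2 + 2).
Proof.
move=> h1 h2 s hm hf.
have [t1 [s1 [e1 l1 m1 f1 r1]]] := h1 s hm hf.
have [|t2 [s2 [e2 l2 m2 [_ f2] r2]]] := h2 s1 m1; first by split.
eexists _, _; split.
- apply: (ExecSeq e1); apply: (ExecSeq e2); exact: ExecAssign.
- by rewrite /= addnA leq_add // leq_add.
- by [].
- exact: fits_upd.
- by rewrite /= upd_same -r2.
Qed.

Lemma computes_if G e b c1 c2 v1 v2 T :
  denotes w m G e b -> (b != 0 -> computes w m G c1 v1 T) ->
  (b = 0 -> computes w m G c2 v2 T) ->
  computes w m G (If e c1 c2) (if b != 0 then v1 else v2) ((ecost e).+1 + T).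
Proof.
move=> he h1 h2 s hm hf; case: eqP => hb /=.
  have [t [s' [e' l' m' f' r']]] := h2 hb s hm hf.
  exists ((ecost e).+1 + t), s'; split=> //; last by rewrite leq_add2l.
  by apply: ExecIfFalse e' => //; rewrite (he s).
case: b he h1 h2 hb => // b he h1 h2 hb.
have [//|t [s' [e' l' m' f' r']]] := h1 _ s hm hf.
exists ((ecost e).+1 + t), s'; split=> //; last by rewrite leq_add2l.
by apply: ExecIfTrue e' => //; rewrite (he s).
Qed.

Lemma computes_iterate (g : nat -> nat) G eb e0 body b T :
  denotes w m G eb b -> b < 2 ^ w -> denotes w m G e0 (g 0) ->
  ecost eb <= 100 -> ecost e0 <= 100 ->
  (forall i, i < b -> computes w m (i :: g i :: G) body (g i.+1) T) ->
  computes w m G (iterate (size G) eb e0 body) (g b) (loopT b T).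
Proof.
move=> hb bw h0 ceb ce0 hbody.
(* Induction on the number [k] of rounds still to come, with the accumulator equal to [g i] when
   round [i] starts. *)
have loop k i s : i + k = b -> mem s = m -> fits (i :: g i :: G) s ->
  exists t s', [/\ exec w (While (Bin Lt (Reg (size G).+1) eb)
       (Seq body (Seq (Assign (size G) (Reg (size G).+2))
          (Assign (size G).+1 (Bin Add (Reg (size G).+1) (Const 1)))))) s t s',
     t <= k.+1 * (T + 115), mem s' = m, fits G s' & regs s' (size G) = g b].
  elim: k i s => [|k IH] i s hik hm hf; have [ri [rg fG]] := hf.
    move: hik; rewrite addn0 => hik; subst i; eexists _, _; split.
    - by apply: ExecWhileFalse; rewrite /= ri (hb s) // ltnn mod0n.
    - by rewrite /=; lia.
    - by [].
    - by [].
    - by [].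
  have ib : i < b by lia.
  have [t1 [s1 [x1 l1 m1 f1 r1]]] := hbody i ib s hm hf.
  have [ri1 [rg1 fG1]] := f1.
  set s2 := State (upd (upd (regs s1) (size G) (g i.+1)) (size G).+1 i.+1) m.
  have [|||t3 [s3 [x3 l3 m3 f3 r3]]] := IH i.+1 s2; first lia.
  - by [].
  - rewrite /s2 /= upd_same; split=> //.
    rewrite upd_other ?upd_same; last lia.
    split=> //; apply: fits_regs fG1 => r hr /=; rewrite !upd_other //; lia.
  eexists _, s3; split; last by [].
  - apply: ExecWhileTrue x3.
    + rewrite /= ri (hb s) // ib modn_small //; lia.
    + apply: (ExecSeq x1); apply: (@ExecSeq _ _ _ _
        (State (upd (regs s1) (size G) (g i.+1)) m)).
        have := ExecAssign w (size G) (Reg (size G).+2) s1.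
        by rewrite /= m1 [regs s1 _]r1; apply.
      have := ExecAssign w (size G).+1 (Bin Add (Reg (size G).+1) (Const 1))
        (State (upd (regs s1) (size G) (g i.+1)) m).
      rewrite /s2 /= upd_other; last lia.
      rewrite ri1 (@modn_small 1); last lia.
      rewrite modn_small ?[i + 1]addn1 //; [by apply | lia].
  - rewrite /= in l3 *; lia.
  - by [].
  - by [].
move=> s hm hf.
set s1 := State (upd (regs s) (size G) (g 0)) m.
set s2 := State (upd (regs s1) (size G).+1 0) m.
have [|||t3 [s3 [x3 l3 m3 f3 r3]]] := loop b 0 s2; rewrite ?add0n //.
- rewrite /s2 /= upd_same; split=> //.
  rewrite upd_other ?upd_same; last lia.
  split=> //; apply: fits_regs hf => r hr /=; rewrite !upd_other //; lia.
eexists _, s3; split; [ | |exact: m3|exact: f3|exact: r3].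
- apply: (@ExecSeq _ _ _ _ s1).
    by have := ExecAssign w (size G) e0 s; rewrite (h0 s) // hm; apply.
  apply: ExecSeq x3.
  by have := ExecAssign w (size G).+1 (Const 0) s1; rewrite /= mod0n; apply.
- by rewrite /loopT /= in l3 *; lia.
Qed.

Lemma computes_summation (f : nat -> nat) G eb body b T :
  denotes w m G eb b -> b < 2 ^ w -> ecost eb <= 100 ->
  \sum_(0 <= i < b) f i < 2 ^ w ->
  (forall i a, i < b -> computes w m (i :: a :: G) body (f i) T) ->
  computes w m G (summation (size G) eb body) (\sum_(0 <= i < b) f i) (sumT b T).
Proof.
move=> hb bw ceb hs hbody.
apply: (computes_iterate (g := fun k => \sum_(0 <= i < k) f i)) => //.
  by rewrite big_geq //; apply: denotes_const; rewrite expn_gt0.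
move=> i ib; apply: computes_eq.
- apply: (computes_bind (hbody i _ ib)); apply: (computes_expr (T := 4)) => //.
  apply: (denotes_bin (o := Add)).
  + do 2!apply: denotes_weaken; exact: denotes_top.
  + exact: denotes_top.
  (* A partial sum is at most the full sum, so the word bound on the latter excludes overflow in
     every round. *)
  + apply: leq_ltn_trans hs; rewrite /= [leqRHS](big_cat_nat (n := i.+1)) //=.
    by rewrite [X in _ <= X + _]big_nat_recr //= leq_addr.
- by rewrite /= big_nat_recr.
- by lia.
Qed.

Lemma runs_impl G c (Q Q' : (nat -> nat) -> Prop) T T' :
  runs w m G c Q T -> (forall m', Q m' -> Q' m') -> T <= T' ->
  runs w m G c Q' T'.
Proof.
move=> h hQ hT s hm hf; have [t [s' [h1 h2 h3 h4]]] := h s hm hf.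
by exists t, s'; split=> //; [apply: leq_trans hT | apply: hQ].
Qed.

Lemma runs_store G e1 e2 a v (Q : (nat -> nat) -> Prop) T :
  denotes w m G e1 a -> denotes w m G e2 v -> Q (upd m a v) ->
  ecost e1 + ecost e2 < T -> runs w m G (Store e1 e2) Q T.
Proof.
move=> h1 h2 hQ hT s hm hf; eexists _, _; split; first exact: ExecStore.
- exact: hT.
- by apply: fits_regs hf.
- by rewrite /= (h1 s) // (h2 s) // hm.
Qed.

Lemma runs_let G c1 c2 v Q T1 T2 :
  computes w m G c1 v T1 -> runs w m (v :: G) c2 Q T2 ->
  runs w m G (Seq c1 c2) Q (T1 + T2).
Proof.
move=> h1 h2 s hm hf.
have [t1 [s1 [e1 l1 m1 f1 r1]]] := h1 s hm hf.
have [|t2 [s2 [e2 l2 [_ f2] q2]]] := h2 s1 m1; first by split.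
exists (t1 + t2), s2; split=> //; [exact: ExecSeq e2 | exact: leq_add].
Qed.

End Logic.

Lemma runs_seq w m G c1 c2 Q1 Q2 T1 T2 :
  runs w m G c1 Q1 T1 -> (forall m', Q1 m' -> runs w m' G c2 Q2 T2) ->
  runs w m G (Seq c1 c2) Q2 (T1 + T2).
Proof.
move=> h1 h2 s hm hf.
have [t1 [s1 [e1 l1 f1 q1]]] := h1 s hm hf.
have [t2 [s2 [e2 l2 f2 q2]]] := h2 _ q1 s1 erefl f1.
exists (t1 + t2), s2; split=> //; [exact: ExecSeq e2 | exact: leq_add].
Qed.

(** The guard evaluates the bound again in a memory that the body has changed, hence the requirement
    that it denotes [b] in every memory satisfying the invariant. *)
Lemma runs_for w (I : nat -> (nat -> nat) -> Prop) m G eb body b T :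
  b < 2 ^ w -> ecost eb <= 100 -> I 0 m ->
  (forall i m', I i m' -> denotes w m' G eb b) ->
  (forall i m', i < b -> I i m' -> runs w m' (i :: G) body (I i.+1) T) ->
  runs w m G (for_loop (size G) eb body) (I b) (loopT b T).
Proof.
move=> bw ceb h0 hb hbody.
have loop k i s : i + k = b -> I i (mem s) -> fits (i :: G) s ->
  exists t s', [/\ exec w (While (Bin Lt (Reg (size G)) eb)
       (Seq body (Assign (size G) (Bin Add (Reg (size G)) (Const 1))))) s t s',
     t <= k.+1 * (T + 115), fits G s' & I b (mem s')].
  elim: k i s => [|k IH] i s hik hm hf; have [ri fG] := hf.
    move: hik; rewrite addn0 => hik; eexists _, _; split.
    - by apply: ExecWhileFalse; rewrite /= ri (hb _ _ hm s) // hik ltnn mod0n.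
    - by rewrite /=; lia.
    - by [].
    - by rewrite -hik.
  have ib : i < b by lia.
  have [t1 [s1 [x1 l1 f1 m1]]] := hbody i _ ib hm s erefl hf.
  have [ri1 fG1] := f1.
  set s2 := State (upd (regs s1) (size G) i.+1) (mem s1).
  have [|||t3 [s3 [x3 l3 f3 m3]]] := IH i.+1 s2; first lia.
  - by [].
  - rewrite /s2 /= upd_same; split=> //; exact: fits_upd.
  eexists _, s3; split; last by [].
  - apply: ExecWhileTrue x3.
    + rewrite /= ri (hb _ _ hm s) // ib modn_small //; lia.
    + apply: (ExecSeq x1).
      have := ExecAssign w (size G) (Bin Add (Reg (size G)) (Const 1)) s1.
      rewrite /s2 /= ri1 (@modn_small 1); last lia.
      rewrite modn_small ?[i + 1]addn1 //; [by apply | lia].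
  - rewrite /= in l3 *; lia.
  - by [].
move=> s hm hf; set s1 := State (upd (regs s) (size G) 0) m.
have [|||t3 [s3 [x3 l3 f3 m3]]] := loop b 0 s1; rewrite ?add0n //.
- by rewrite /s1 /= upd_same; split=> //; apply: fits_upd.
eexists _, s3; split; [ | |exact: f3|exact: m3].
- apply: ExecSeq x3.
  by have := ExecAssign w (size G) (Const 0) s; rewrite /= mod0n hm; apply.
- by rewrite /loopT /= in l3 *; lia.
Qed.

(** * Counting points and descending pairs *)

Definition dominance (p : nat -> nat) x y := \sum_(0 <= i < x) (p i < y).

Definition box (p : nat -> nat) x1 x2 y1 y2 :=
  \sum_(x1 <= i < x2) (y1 <= p i < y2).

Definition corner_inv (p : nat -> nat) x y :=
  \sum_(0 <= i < x) \sum_(0 <= j < x) [&& i < j, p j < p i & p i < y].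

Definition cross_inv (p : nat -> nat) x1 x2 y1 y2 :=
  \sum_(0 <= i < x1) \sum_(x1 <= j < x2) [&& y1 <= p j, p j < p i & p i < y2].

Definition desc_pairs (p : nat -> nat) x1 x2 y1 y2 :=
  \sum_(x1 <= i < x2) \sum_(x1 <= j < x2)
     [&& i < j, y1 <= p j, p j < p i & p i < y2].

(* Strip points are addressed by their rank among the points of the strip. *)
Definition rank_cross_inv n (p : nat -> nat) y1 y2 a b :=
  \sum_(0 <= i < n) \sum_(0 <= j < n)
    [&& y1 <= p j, p j < p i, p i < y2, box p 0 i y1 y2 < a,
        a <= box p 0 j y1 y2 & box p 0 j y1 y2 < b].

Lemma sum_bool_le (P Q : nat -> bool) a b :
  (forall i, a <= i < b -> P i -> Q i) ->
  \sum_(a <= i < b) P i <= \sum_(a <= i < b) Q i.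
Proof.
move=> h; rewrite big_nat [leqRHS]big_nat; apply: leq_sum => i hi.
by have := h i hi; case: (P i) => // ->.
Qed.

Lemma sum_bool_size (P : nat -> bool) a b : \sum_(a <= i < b) P i <= b - a.
Proof.
apply: leq_trans (_ : \sum_(a <= i < b) 1 <= _).
  by apply: leq_sum => i _; case: (P i).
by rewrite sum_nat_const_nat muln1.
Qed.

(** Brings sums over different intervals to the common range [0, n), where an identity between
    counts can be checked term by term. *)
Lemma sum_trim n a b (f : nat -> nat) : b <= n ->
  \sum_(a <= i < b) f i = \sum_(0 <= i < n) (a <= i < b) * f i.
Proof.
move=> hb; have [hab|hab] := leqP a b; last first.
  rewrite big_geq; last lia.
  by rewrite big1 // => i _; rewrite (_ : (a <= i < b) = false) //; lia.
rewrite [RHS](big_cat_nat (n := b)) //= [X in _ = X + _](big_cat_nat (n := a)) //=.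
rewrite [X in X + _ + _]big_nat [X in _ + X]big_nat [X in X + _ + _]big1.
  rewrite [X in _ + X]big1 ?add0n ?addn0.
    by rewrite big_nat [RHS]big_nat; apply: eq_bigr => i ->; rewrite mul1n.
  by move=> i hi; rewrite (_ : (a <= i < b) = false) //; lia.
by move=> i hi; rewrite (_ : (a <= i < b) = false) //; lia.
Qed.

Lemma sum_trim2 n a b c d (f : nat -> nat -> nat) : b <= n -> d <= n ->
  \sum_(a <= i < b) \sum_(c <= j < d) f i j =
  \sum_(0 <= i < n) \sum_(0 <= j < n) (a <= i < b) * (c <= j < d) * f i j.
Proof.
move=> hb hd; rewrite (sum_trim _ _ hb); apply: eq_bigr => i _.
by rewrite (sum_trim _ _ hd) big_distrr; apply: eq_bigr => j _; rewrite /= mulnA.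
Qed.

(** * Recurrences and splittings of the counts *)

Section Counting.
Variable p : nat -> nat.

Lemma dominanceD x1 x2 y : x1 <= x2 ->
  dominance p x2 y = dominance p x1 y + \sum_(x1 <= i < x2) (p i < y).
Proof. by move=> h; rewrite /dominance (big_cat_nat (n := x1)). Qed.

Lemma box_dominance x1 x2 y1 y2 : (x1 <= x2) || (y1 <= y2) ->
  box p x1 x2 y1 y2 = (dominance p x2 y2 + dominance p x1 y1)
                    - (dominance p x1 y2 + dominance p x2 y1).
Proof.
have [h _|h] := leqP x1 x2; last first.
  rewrite /box big_geq => [/= h'|]; last exact: ltnW.
  rewrite (dominanceD y1 (ltnW h)) (dominanceD y2 (ltnW h)).
  have := @sum_bool_le (fun i => p i < y1) (fun i => p i < y2) x2 x1.
  by move=> H; have := H ltac:(move=> i _; lia); lia.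
rewrite (dominanceD y1 h) (dominanceD y2 h).
have [h'|h'] := leqP y1 y2.
  have -> : \sum_(x1 <= i < x2) (p i < y2) =
            box p x1 x2 y1 y2 + \sum_(x1 <= i < x2) (p i < y1).
    by rewrite /box -big_split /=; apply: eq_bigr => i _; lia.
  by lia.
have -> : box p x1 x2 y1 y2 = 0 by rewrite /box big1 // => i _; lia.
have := @sum_bool_le (fun i => p i < y2) (fun i => p i < y1) x1 x2.
by move=> H; have := H ltac:(move=> i _; lia); lia.
Qed.

Lemma box_recr x1 x y1 y2 : x1 <= x ->
  box p x1 x.+1 y1 y2 = box p x1 x y1 y2 + (y1 <= p x < y2).
Proof. by move=> h; rewrite /box big_nat_recr. Qed.

Lemma box_size x1 x2 y1 y2 : box p x1 x2 y1 y2 <= x2 - x1.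
Proof. exact: sum_bool_size. Qed.

Lemma box_mono x x' y1 y2 : x <= x' -> box p 0 x y1 y2 <= box p 0 x' y1 y2.
Proof. by move=> h; rewrite /box (big_cat_nat (n := x) (p := x')) //= leq_addr. Qed.

Lemma box_rank_lt x x' y1 y2 : y1 <= p x < y2 ->
  (box p 0 x y1 y2 < box p 0 x' y1 y2) = (x < x').
Proof.
move=> hx; apply/idP/idP => [|h].
  by rewrite ltnNge => h; rewrite ltnNge; apply: contraNN h => h; apply: box_mono.
by apply: leq_trans (box_mono _ _ h); rewrite box_recr // hx addn1.
Qed.

(** The rank grows by at most one per abscissa and so cannot skip the value [t]. *)
Lemma box_rank_ex x y1 y2 t : t < box p 0 x y1 y2 ->
  exists e, [/\ e < x, y1 <= p e < y2 & box p 0 e y1 y2 = t].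
Proof.
elim: x => [|x IH]; first by rewrite /box big_geq.
rewrite box_recr // => h; have [h'|h'] := ltnP t (box p 0 x y1 y2).
  by have [e [? ? ?]] := IH h'; exists e; split=> //; apply: leqW.
by exists x; move: h h'; case: (_ <= p x < _) => /=; split=> //; lia.
Qed.

(** The new column can only be the right end of a pair; its partners are the points to its left,
    higher than it and below [y]. *)
Lemma corner_inv_recr x y :
  corner_inv p x.+1 y = corner_inv p x y + box p 0 x (p x).+1 y.
Proof.
rewrite /corner_inv big_nat_recr //= [X in _ + X]big_nat [X in _ + X]big1 ?addn0.
  rewrite /box -big_split /=; apply: eq_big_nat => i hi.
  by rewrite big_nat_recr //=; congr (_ + _); lia.
by move=> j hj; lia.
Qed.

Lemma corner_inv0 x : corner_inv p x 0 = 0.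
Proof. by rewrite /corner_inv; do 2!rewrite big1 // => ? _; rewrite ltn0 !andbF. Qed.

Lemma corner_inv_walk b r y :
  corner_inv p (b + r) y = corner_inv p b y
    + \sum_(0 <= t < r) box p 0 (b + t) (p (b + t)).+1 y.
Proof.
elim: r => [|r IH]; first by rewrite big_geq // !addn0.
by rewrite addnS corner_inv_recr IH big_nat_recr //= addnA.
Qed.

(** Both points lie below [y1], or both in the strip, or only the left one lies in the strip. In the
    last case order and heights are automatic, so the pairs form a full product. *)
Lemma cross_inv_split x1 x2 y1 y2 : y1 <= y2 ->
  cross_inv p x1 x2 0 y2 = cross_inv p x1 x2 0 y1 +
    (cross_inv p x1 x2 y1 y2 + box p 0 x1 y1 y2 * box p x1 x2 0 y1).
Proof.
move=> h; rewrite /cross_inv /box big_distrlr /= -!big_split /=.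
apply: eq_bigr => i _; rewrite -!big_split /=; apply: eq_bigr => j _.
by rewrite mulnb; lia.
Qed.

Lemma cross_inv0 x1 x2 y : cross_inv p x1 x2 y 0 = 0.
Proof. by rewrite /cross_inv; do 2!rewrite big1 // => ? _; rewrite ltn0 !andbF. Qed.

(** Clearing the bits of [y] from the lowest upwards brings it down to 0. Step [k] removes a dyadic
    interval of length [2 ^ k] if bit [k] is set, and nothing otherwise. *)
Lemma cross_inv_dyadic K x1 x2 y : y < 2 ^ K ->
  cross_inv p x1 x2 0 y =
  \sum_(0 <= k < K) (cross_inv p x1 x2 (y %/ 2 ^ k.+1 * 2 ^ k.+1) (y %/ 2 ^ k * 2 ^ k)
     + box p 0 x1 (y %/ 2 ^ k.+1 * 2 ^ k.+1) (y %/ 2 ^ k * 2 ^ k)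
       * box p x1 x2 0 (y %/ 2 ^ k.+1 * 2 ^ k.+1)).
Proof.
move=> hy; suff H L : cross_inv p x1 x2 0 y =
    cross_inv p x1 x2 0 (y %/ 2 ^ L * 2 ^ L) + \sum_(0 <= k < L)
    (cross_inv p x1 x2 (y %/ 2 ^ k.+1 * 2 ^ k.+1) (y %/ 2 ^ k * 2 ^ k)
     + box p 0 x1 (y %/ 2 ^ k.+1 * 2 ^ k.+1) (y %/ 2 ^ k * 2 ^ k)
       * box p x1 x2 0 (y %/ 2 ^ k.+1 * 2 ^ k.+1)).
  by rewrite (H K) (divn_small hy) mul0n cross_inv0 add0n.
elim: L => [|L IH]; first by rewrite big_geq // expn0 divn1 muln1 addn0.
rewrite big_nat_recr //= {1}IH (@cross_inv_split _ _ (y %/ 2 ^ L.+1 * 2 ^ L.+1)).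
  by lia.
by rewrite expnSr divnMA mulnA [leqRHS]mulnC mulnAC mulnC leq_mul // leq_divM.
Qed.

Lemma cross_inv_recr x1 x2 y1 y2 : x1 <= x2 -> y1 <= p x2 < y2 ->
  cross_inv p x1 x2.+1 y1 y2 = cross_inv p x1 x2 y1 y2 + box p 0 x1 (p x2).+1 y2.
Proof.
move=> h hp; rewrite /cross_inv /box -big_split /=; apply: eq_bigr => i _.
by rewrite big_nat_recr //=; congr (_ + _); lia.
Qed.

(** When the point at [x1] changes sides it stops being a right end, losing the higher strip points
    to its left, and becomes a left end, gaining the lower ones to its right. *)
Lemma cross_inv_step x1 x2 y1 y2 : x1 < x2 -> y1 <= p x1 < y2 ->
  cross_inv p x1.+1 x2 y1 y2 + box p 0 x1 (p x1).+1 y2 =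
  cross_inv p x1 x2 y1 y2 + box p x1.+1 x2 y1 (p x1).
Proof.
move=> h hp; rewrite /cross_inv big_nat_recr //= addnAC; congr (_ + _).
  rewrite /box -big_split /=; apply: eq_bigr => i _.
  by rewrite [RHS]big_ltn // addnC; congr (_ + _); lia.
by apply: eq_bigr => j _; lia.
Qed.

(** Rank is strictly increasing on the points of the strip, so abscissas may be compared through
    ranks. Hence the count depends on [x1] and [x2] only through their ranks, which is what
    compresses the table. *)
Lemma cross_inv_rank n x1 x2 y1 y2 : x1 <= x2 -> x2 <= n ->
  cross_inv p x1 x2 y1 y2 =
  rank_cross_inv n p y1 y2 (box p 0 x1 y1 y2) (box p 0 x2 y1 y2).
Proof.
move=> h12 h2; rewrite /cross_inv (sum_trim2 (n := n)) //; last lia.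
apply: eq_bigr => i _; apply: eq_bigr => j _.
case hp : [&& y1 <= p j, p j < p i & p i < y2]; last first.
  by rewrite muln0; symmetry; apply/eqP; rewrite eqb0; apply/negP; lia.
have hi : y1 <= p i < y2 by lia.
have hj : y1 <= p j < y2 by lia.
rewrite (box_rank_lt _ hi) (leqNgt (box _ _ x1 _ _)) !(box_rank_lt _ hj) -leqNgt.
by lia.
Qed.

Lemma rank_cross_inv_empty n y1 y2 a b : b <= a ->
  rank_cross_inv n p y1 y2 a b = 0.
Proof. by move=> h; rewrite /rank_cross_inv; do 2!rewrite big1 // => ? _; lia. Qed.

(* Moving the separating abscissa past one strip point after another. *)
Lemma cross_inv_walk n y1 y2 (e : nat -> nat) a r x1 x2 :
  x1 <= x2 -> x2 <= n -> box p 0 x1 y1 y2 = a + r ->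
  (forall t, t < a + r -> y1 <= p (e t) < y2 /\ box p 0 (e t) y1 y2 = t) ->
  cross_inv p x1 x2 y1 y2 + \sum_(0 <= t < r) box p 0 (e (a + t)) (p (e (a + t))).+1 y2 =
  rank_cross_inv n p y1 y2 a (box p 0 x2 y1 y2)
   + \sum_(0 <= t < r) box p (e (a + t)).+1 x2 y1 (p (e (a + t))).
Proof.
move=> h12 h2; elim: r x1 h12 => [|r IH] x1 h12 hx he.
  rewrite !big_geq // !addn0; rewrite addn0 in hx.
  by rewrite (cross_inv_rank _ _ h12 h2) hx.
have [hp hr] := he (a + r) ltac:(lia).
have ex1 : e (a + r) < x1 by rewrite -(box_rank_lt _ hp) hr hx; lia.
have ex2 : e (a + r) < x2 by lia.
have := IH (e (a + r)) (ltnW ex2) hr ltac:(move=> t ht; apply: he; lia).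
have := cross_inv_step ex2 hp.
(* Moving [x1] back to just behind the last strip point on its left changes no rank, hence no
   count. *)
have -> : cross_inv p (e (a + r)).+1 x2 y1 y2 = cross_inv p x1 x2 y1 y2.
  by rewrite !(cross_inv_rank (n := n)) // box_recr // hr hp hx; congr rank_cross_inv; lia.
by rewrite !big_nat_recr //=; lia.
Qed.

(** With [X] the strip point of rank [a], rank below [a] means lying left of [X]. The step from rank
    [r] to [r.+1] then adds the column [j] to a crossing count with separator [X], at the price of
    one point count. *)
Lemma rank_cross_inv_recr n y1 y2 a r X j :
  j < n -> y1 <= p j < y2 -> box p 0 j y1 y2 = r -> a <= r ->
  y1 <= p X < y2 -> box p 0 X y1 y2 = a ->
  rank_cross_inv n p y1 y2 a r.+1 =
  rank_cross_inv n p y1 y2 a r + box p 0 X (p j).+1 y2.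
Proof.
move=> hj hp hr har hX hXa.
have hXj : X <= j by rewrite leqNgt -(box_rank_lt _ hp) hr hXa -leqNgt.
rewrite -hr -hXa -cross_inv_rank //; last lia.
have -> : (box p 0 j y1 y2).+1 = box p 0 j.+1 y1 y2 by rewrite box_recr // hp addn1.
by rewrite -cross_inv_rank //; [rewrite cross_inv_recr | lia].
Qed.

Lemma desc_pairs_le x1 x2 y1 y2 : desc_pairs p x1 x2 y1 y2 <= (x2 - x1) * (x2 - x1).
Proof.
apply: leq_trans (_ : \sum_(x1 <= i < x2) (x2 - x1) <= _).
  by apply: leq_sum => i _; apply: sum_bool_size.
by rewrite sum_nat_const_nat.
Qed.

Lemma corner_inv_le x y : corner_inv p x y <= x * x.
Proof.
apply: leq_trans (_ : \sum_(0 <= i < x) x <= _); last by rewrite sum_nat_const_nat subn0.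
by apply: leq_sum => i _; apply: leq_trans (sum_bool_size _ _ _) _; rewrite subn0.
Qed.

Lemma cross_inv_le x1 x2 y1 y2 : cross_inv p x1 x2 y1 y2 <= x1 * x2.
Proof.
apply: leq_trans (_ : \sum_(0 <= i < x1) x2 <= _); last by rewrite sum_nat_const_nat subn0.
by apply: leq_sum => i _; apply: leq_trans (sum_bool_size _ _ _) _; rewrite leq_subr.
Qed.

Lemma rank_cross_inv_le n y1 y2 a b : rank_cross_inv n p y1 y2 a b <= n * n.
Proof.
apply: leq_trans (_ : \sum_(0 <= i < n) n <= _); last by rewrite sum_nat_const_nat subn0.
by apply: leq_sum => i _; apply: leq_trans (sum_bool_size _ _ _) _; rewrite subn0.
Qed.

End Counting.

(** * Point counts from dyadic cells *)

Definition dyadic_cell n (p : nat -> nat) k l a b :=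
  \sum_(0 <= i < n) ((i %/ 2 ^ l == a) && (p i %/ 2 ^ k == b)).

(* The one-bits of [x] cut [0, x) into dyadic intervals. *)
Lemma ltn_dyadic K i x : x < 2 ^ K ->
  (i < x) = \sum_(0 <= l < K)
    (((x %/ 2 ^ l) %% 2 != 0) && (i %/ 2 ^ l == (x %/ 2 ^ l).-1)) :> nat.
Proof.
move=> hx.
suff H L : (i < x) = (i < x %/ 2 ^ L * 2 ^ L) + \sum_(0 <= l < L)
    (((x %/ 2 ^ l) %% 2 != 0) && (i %/ 2 ^ l == (x %/ 2 ^ l).-1)) :> nat.
  by rewrite (H K) (divn_small hx) mul0n ltn0 add0n.
elim: L => [|L IH]; first by rewrite big_geq // expn0 divn1 muln1 addn0.
rewrite big_nat_recr //= IH [2 ^ L.+1]expnSr divnMA -!ltn_divLR ?muln_gt0 ?expn_gt0 //.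
rewrite divnMA; move: (x %/ 2 ^ L) (i %/ 2 ^ L) => X I; lia.
Qed.

(** The expansions of [i < x] and [p i < y] into dyadic intervals are multiplied and summed over all
    points; each product of two intervals is one cell. *)
Lemma dominance_dyadic K n p x y : x <= n -> x < 2 ^ K -> y < 2 ^ K ->
  dominance p x y = \sum_(0 <= k < K) \sum_(0 <= l < K)
    (if (y %/ 2 ^ k) %% 2 * ((x %/ 2 ^ l) %% 2) != 0
     then dyadic_cell n p k l (x %/ 2 ^ l).-1 (y %/ 2 ^ k).-1 else 0).
Proof.
move=> hxn hx hy; rewrite /dominance (sum_trim _ _ hxn).
transitivity (\sum_(0 <= i < n) \sum_(0 <= k < K) \sum_(0 <= l < K)
  (if (y %/ 2 ^ k) %% 2 * ((x %/ 2 ^ l) %% 2) != 0 then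
    (i %/ 2 ^ l == (x %/ 2 ^ l).-1) && (p i %/ 2 ^ k == (y %/ 2 ^ k).-1) : nat
   else 0)).
  apply: eq_bigr => i _; rewrite /= mulnC.
  rewrite (ltn_dyadic (p i) hy) (ltn_dyadic i hx) big_distrlr /=.
  apply: eq_bigr => k _; apply: eq_bigr => l _.
  rewrite muln_eq0 negb_or mulnb.
  by do 2!case: (_ != 0) => //=; rewrite ?andbF // andbC.
rewrite exchange_big /=; apply: eq_bigr => k _.
rewrite exchange_big /=; apply: eq_bigr => l _.
by case: ifP => // _; rewrite big1.
Qed.

Lemma corner_inv_trim n p x y : x <= n ->
  corner_inv p x y = \sum_(0 <= i < n) \sum_(0 <= j < n)
    [&& i < x, j < x, i < j, p j < p i & p i < y].
Proof.
move=> hx; rewrite /corner_inv (sum_trim2 (n := n)) //.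
by apply: eq_bigr => i _; apply: eq_bigr => j _; rewrite !mulnb -!andbA.
Qed.

(** * Identities that involve the inverse permutation *)

Section Permutation.
Variables (n : nat) (p pv : nat -> nat).
Hypothesis p_lt : forall i, i < n -> p i < n.
Hypothesis pv_lt : forall i, i < n -> pv i < n.
Hypothesis pK : forall i, i < n -> pv (p i) = i.
Hypothesis pvK : forall i, i < n -> p (pv i) = i.

Lemma sum_reindex (f : nat -> nat) :
  \sum_(0 <= a < n) f a = \sum_(0 <= i < n) f (p i).
Proof.
rewrite -(big_map p xpredT f); apply: perm_big; apply: uniq_perm.
- exact: iota_uniq.
- rewrite map_inj_in_uniq ?iota_uniq // => i j.
  rewrite !mem_index_iota /= => hi hj h.
  by rewrite -(pK hi) h pK.
- move=> a; rewrite mem_index_iota /=; apply/idP/mapP => [ha|[i]].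
    by exists (pv a); rewrite ?pvK // mem_index_iota /= pv_lt.
  by rewrite mem_index_iota /= => hi ->; apply: p_lt.
Qed.

(** Raising the bound from [y] admits one more upper left point, the one at abscissa [pv y]; its
    partners lie to its right and below it. This fills the corner table at one point count per
    entry. *)
Lemma corner_inv_recr_y x y : x <= n -> y < n ->
  corner_inv p x y.+1 = corner_inv p x y + box p (pv y).+1 x 0 y.
Proof.
move=> hx hy; rewrite !(corner_inv_trim _ _ hx) /box [X in _ = _ + X](sum_trim (n := n)) //.
have -> : \sum_(0 <= j < n) (pv y < j < x) * (0 <= p j < y) =
  \sum_(0 <= i < n) \sum_(0 <= j < n) ((i == pv y) && (pv y < j < x) && (p j < y)).
  rewrite exchange_big /=; apply: eq_big_nat => j hj.
  rewrite (bigD1_seq (pv y)) /= ?mem_index_iota ?iota_uniq ?pv_lt //.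
  rewrite eqxx mulnb big1 ?addn0 // => i /negbTE -> //.
rewrite -big_split; apply: eq_big_nat => i hi /=.
rewrite -big_split; apply: eq_big_nat => j hj /=.
have E : (i == pv y) = (p i == y).
  by apply/eqP/eqP => [->|<-]; rewrite ?pvK ?pK.
by rewrite E; case: eqP => [<-|hne] /=; rewrite ?pK //; lia.
Qed.

(** Reflection in the diagonal keeps pairs descending and exchanges their ends, so the separator at
    [y1] now separates the ordinates of the original pair. *)
Lemma cross_inv_transpose y1 y2 x : y2 <= n -> y1 <= y2 ->
  cross_inv pv y1 y2 0 x =
  \sum_(0 <= i < n) \sum_(0 <= j < n) [&& p j < y1, y1 <= p i, p i < y2, i < j & j < x].
Proof.
move=> h2 h12; rewrite /cross_inv (sum_trim2 (n := n)) //; last lia.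
rewrite [LHS]sum_reindex exchange_big [LHS]sum_reindex /=.
apply: eq_big_nat => i hi; apply: eq_big_nat => j hj.
by rewrite !pK // !mulnb; congr nat_of_bool; lia.
Qed.

(** Start from the pairs with [j < x2] and [p i < y2], remove those with [i < x1] and those with
    [p j < y1], and restore those with both. Each removed class splits in two, by [j < x1] or by
    [p i < y1], into a corner count and a crossing count. The restored class splits in four; its
    part with [x1 <= j] and [y1 <= p i] is the product of boxes. *)
Lemma desc_pairs_decomposition x1 x2 y1 y2 :
  x1 <= x2 -> x2 <= n -> y1 <= y2 -> y2 <= n ->
  desc_pairs p x1 x2 y1 y2 + (corner_inv p x1 y2 + corner_inv p x2 y1
    + cross_inv p x1 x2 0 y2 + cross_inv pv y1 y2 0 x2) =
  corner_inv p x2 y2 + corner_inv p x1 y1 + cross_inv p x1 x2 0 y1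
    + cross_inv pv y1 y2 0 x1 + box p 0 x1 y1 y2 * box p x1 x2 0 y1.
Proof.
move=> hx hxn hy hyn; rewrite !cross_inv_transpose //.
have hx1 : x1 <= n by lia.
rewrite !(corner_inv_trim _ _ hxn, corner_inv_trim _ _ hx1).
rewrite /box big_distrlr /= /desc_pairs /cross_inv.
rewrite [X in X + _ = _](sum_trim2 (n := n)) //.
rewrite [X in _ = _ + X](sum_trim2 (n := n)) //.
rewrite [X in _ + (_ + X + _) = _](sum_trim2 (n := n)) //.
rewrite [X in _ = _ + X + _ + _](sum_trim2 (n := n)) //.
rewrite -!big_split; apply: eq_bigr => i _ /=.
rewrite -!big_split; apply: eq_bigr => j _ /=.
rewrite !mulnb; case: (ltnP i j) => hij; last by lia.
case: (ltnP (p j) (p i)) => hp; last by rewrite ?andbF ?andFb ?add0n; lia.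
(* For a descending pair the eight comparisons are tied only by these implications; the rest is a
   finite check over booleans. *)
have : [&& (j < x1) ==> (i < x1), (j < x2) ==> (i < x2), (i < x1) ==> (i < x2),
  (j < x1) ==> (j < x2), (p i < y1) ==> (p j < y1), (p i < y2) ==> (p j < y2),
  (p i < y1) ==> (p i < y2) & (p j < y1) ==> (p j < y2)] by lia.
rewrite !(leqNgt x1) !(leqNgt y1).
move: (i < x1) (j < x1) (i < x2) (j < x2) (p i < y1) (p j < y1) (p i < y2) (p j < y2).
by do 8!case.
Qed.

End Permutation.

(** * Ascending pairs and the link with [count_pairs] *)

Definition asc_pairs (p : nat -> nat) x1 x2 y1 y2 :=
  \sum_(x1 <= i < x2) \sum_(x1 <= j < x2)
     [&& i < j, y1 <= p i, p i < p j & p j < y2].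

(** The square of the number of points counts each unordered pair ([P]) twice and the diagonal once.
    Injectivity makes every pair ascending or descending. *)
Lemma asc_pairs_desc_pairs p n x1 x2 y1 y2 : x2 <= n ->
  {in gtn n &, injective p} ->
  asc_pairs p x1 x2 y1 y2 = (box p x1 x2 y1 y2 * box p x1 x2 y1 y2
     - box p x1 x2 y1 y2) %/ 2 - desc_pairs p x1 x2 y1 y2.
Proof.
move=> hx hp.
pose r i : nat := y1 <= p i < y2.
pose P := \sum_(x1 <= i < x2) \sum_(x1 <= j < x2) ((i < j) * (r i * r j)).
have -> : box p x1 x2 y1 y2 * box p x1 x2 y1 y2 = P + P + box p x1 x2 y1 y2.
  rewrite {1 2}/box big_distrlr /= [X in _ = _ + X + _]exchange_big /= -big_split /=.
  rewrite -/(box _ _ _ _ _) /box -big_split /=; apply: eq_big_nat => i hi.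
  have E : r i = \sum_(x1 <= j < x2) ((i == j) * (r i * r j)) :> nat.
    rewrite (bigD1_seq i) /= ?mem_index_iota ?iota_uniq // eqxx mul1n /r mulnb andbb.
    by rewrite big1 ?addn0 // => j; rewrite eq_sym => /negbTE ->.
  rewrite [X in _ = _ + X]E -!big_split; apply: eq_bigr => j _ /=.
  by rewrite /r !mulnb; lia.
have -> : (P + P + box p x1 x2 y1 y2 - box p x1 x2 y1 y2) %/ 2 = P by lia.
suff -> : P = asc_pairs p x1 x2 y1 y2 + desc_pairs p x1 x2 y1 y2 by lia.
rewrite /P -big_split; apply: eq_big_nat => i hi /=.
rewrite -big_split; apply: eq_big_nat => j hj /=.
rewrite /r !mulnb; case: (ltnP i j) => hij /=; last by lia.
have : p i <> p j by move=> /hp; rewrite !inE /=; lia.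
by lia.
Qed.

(** A total function on naturals, so that counts become interval sums; 0 is a default value outside
    [0, n). *)
Definition perm_fun n (s : 'S_n) (i : nat) : nat :=
  if insub i is Some j then s (j : 'I_n) else 0.

Lemma perm_funE n (s : 'S_n) (i : 'I_n) : perm_fun s i = s i.
Proof. by rewrite /perm_fun valK. Qed.

Lemma perm_fun_lt n (s : 'S_n) i : i < n -> perm_fun s i < n.
Proof. by move=> hi; rewrite (perm_funE s (Ordinal hi)). Qed.

Lemma perm_funK n (s : 'S_n) i : i < n -> perm_fun s^-1 (perm_fun s i) = i.
Proof. by move=> hi; rewrite (perm_funE s (Ordinal hi)) perm_funE permK. Qed.

(** Shifting coordinates down by one lowers the closed left ends by one, while the right ends keep
    their value and become exclusive. *)
Lemma count_pairs_sum (d : direction) n (s : 'S_n) R : rect_sub n R ->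
  count_pairs d s R =
  (if d is Ascending then asc_pairs else desc_pairs)
    (perm_fun s) (rx1 R).-1 (rx2 R) (ry1 R).-1 (ry2 R).
Proof.
case: R => x1 x2 y1 y2; rewrite /rect_sub /= => hR.
have -> : count_pairs d s (Rect x1 x2 y1 y2) =
  \sum_(0 <= i < n) \sum_(0 <= j < n) [&& i < j,
    (if d is Ascending then perm_fun s i < perm_fun s j
     else ~~ (perm_fun s i < perm_fun s j)),
    x1 <= i.+1 <= x2, y1 <= (perm_fun s i).+1 <= y2,
    x1 <= j.+1 <= x2 & y1 <= (perm_fun s j).+1 <= y2].
  rewrite /count_pairs cardsE -sum1_card big_mkcond /=.
  rewrite [RHS]big_mkord; under [RHS]eq_bigr do rewrite big_mkord.
  rewrite [RHS]pair_bigA /=; apply: eq_bigr => -[i j] _ /=.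
  rewrite !perm_funE unfold_in /= /in_rect /= ltnS.
  by rewrite -[LHS]/(nat_of_bool _); congr nat_of_bool; case: d => /=; rewrite ltnS -!andbA.
have inj : {in gtn n &, injective (perm_fun s)}.
  by move=> i j; rewrite !inE => hi hj h; rewrite -(perm_funK s hi) h perm_funK.
case: d; rewrite /asc_pairs /desc_pairs [RHS](sum_trim2 (n := n)); try lia.
  by apply: eq_bigr => i _; apply: eq_bigr => j _; rewrite !mulnb; congr nat_of_bool; lia.
apply: eq_big_nat => i hi; apply: eq_big_nat => j hj.
rewrite !mulnb; congr nat_of_bool; case: (ltnP i j) => hij /=; last by rewrite andbF.
(* The specification calls a pair descending when it is not ascending; injectivity makes the
   inequality strict. *)
have : perm_fun s i <> perm_fun s j by move=> /inj; rewrite !inE /=; lia.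
by lia.
Qed.

Local Notation "n .+5" := n.+4.+1 (at level 1, left associativity, format "n .+5").
Local Notation "n .+6" := n.+4.+2 (at level 1, left associativity, format "n .+6").
Local Notation "n .+7" := n.+4.+3 (at level 1, left associativity, format "n .+7").
Local Notation "n .+8" := n.+4.+4 (at level 1, left associativity, format "n .+8").
Local Notation "n .+9" := n.+4.+4.+1 (at level 1, left associativity, format "n .+9").

Lemma loopT_mono b b' T T' : b <= b' -> T <= T' -> loopT b T <= loopT b' T'.
Proof. by move=> hb hT; rewrite /loopT leq_mul // leq_add2r. Qed.

Lemma sumT_mono b b' T T' : b <= b' -> T <= T' -> sumT b T <= sumT b' T'.
Proof. by move=> hb hT; rewrite /sumT loopT_mono // leq_add2r. Qed.

Section Binops.
Variables (w : nat) (m : nat -> nat).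
Implicit Types (G : seq nat) (e : expr).

Lemma denotes_add G e1 e2 a b :
  denotes w m G e1 a -> denotes w m G e2 b -> a + b < 2 ^ w ->
  denotes w m G (Bin Add e1 e2) (a + b).
Proof. exact: (denotes_bin (o := Add)). Qed.

Lemma denotes_mul G e1 e2 a b :
  denotes w m G e1 a -> denotes w m G e2 b -> a * b < 2 ^ w ->
  denotes w m G (Bin Mul e1 e2) (a * b).
Proof. exact: (denotes_bin (o := Mul)). Qed.

Lemma denotes_sub G e1 e2 a b :
  denotes w m G e1 a -> denotes w m G e2 b -> a < 2 ^ w ->
  denotes w m G (Bin Sub e1 e2) (a - b).
Proof.
move=> h1 h2 h; apply: (denotes_bin (o := Sub)) => //.
by apply: leq_ltn_trans h; apply: leq_subr.
Qed.

Lemma denotes_div G e1 e2 a b :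
  denotes w m G e1 a -> denotes w m G e2 b -> a < 2 ^ w ->
  denotes w m G (Bin Div e1 e2) (a %/ b).
Proof.
move=> h1 h2 h; apply: (denotes_bin (o := Div)) => //.
by apply: leq_ltn_trans h; apply: leq_div.
Qed.

Lemma denotes_mod G e1 e2 a b :
  denotes w m G e1 a -> denotes w m G e2 b -> a < 2 ^ w ->
  denotes w m G (Bin Mod e1 e2) (a %% b).
Proof.
move=> h1 h2 h; apply: (denotes_bin (o := Mod)) => //.
by apply: leq_ltn_trans h; apply: leq_mod.
Qed.

End Binops.

(** * The query algorithm *)

(* Memory layout: cell 0 holds [n], cells 1, ..., n the input; the arrays live in
   the blocks [t * N ^ 4, (t + 1) * N ^ 4) with [t >= 1], where [N = 2 n + 2]. As all
   cells are 0 at the start, the arrays may be sparse at no cost in time. *)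
Definition addr n t a b c d :=
  (((t * (2 * n + 2) + a) * (2 * n + 2) + b) * (2 * n + 2) + c) * (2 * n + 2) + d.

Definition En := Fetch (Const 0).
Definition EN := Bin Add (Bin Add En En) (Const 2).
Definition horner e e' := Bin Add (Bin Mul e EN) e'.
Definition Eaddr t a b c d := horner (horner (horner (horner (Const t) a) b) c) d.
(** A query starts with nothing but the rectangle in its registers, so the parameter and the number
    of levels are kept in block 1. *)
Definition Eparam := Fetch (Eaddr 1 (Const 0) (Const 0) (Const 0) (Const 0)).
Definition EK := Fetch (Eaddr 1 (Const 0) (Const 0) (Const 0) (Const 1)).

(* The two copies [o = 0, 1] of each array serve the permutation and its inverse. *)
Definition val_tag o := 2 + o.
Definition cell_tag o := 4 + o.
Definition sel_tag o := 6 + o.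
Definition cross_tag o := 8 + o.
Definition corner_tag o := 10 + o.
Arguments addr : simpl never.
Arguments val_tag : simpl never.
Arguments cell_tag : simpl never.
Arguments sel_tag : simpl never.
Arguments cross_tag : simpl never.
Arguments corner_tag : simpl never.

Definition Evalue o e := Fetch (Eaddr (val_tag o) (Const 0) (Const 0) (Const 0) e).

Definition pow_code d ek :=
  iterate d ek (Const 1) (Assign d.+2 (Bin Add (Reg d) (Reg d))).

Definition dominance_code o d ex ey :=
  summation d EK (summation d.+2 EK
    (bind d.+4 (pow_code d.+4 (Reg d.+1))
    (bind d.+5 (pow_code d.+5 (Reg d.+3))
    (If (Bin Mul (Bin Mod (Bin Div ey (Reg d.+4)) (Const 2))
                 (Bin Mod (Bin Div ex (Reg d.+5)) (Const 2)))
       (Assign d.+6 (Fetch (Eaddr (cell_tag o) (Reg d.+1) (Reg d.+3)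
           (Bin Sub (Bin Div ex (Reg d.+5)) (Const 1))
           (Bin Sub (Bin Div ey (Reg d.+4)) (Const 1)))))
       (Assign d.+6 (Const 0)))))).

Definition box_code o d ex1 ex2 ey1 ey2 :=
  bind d (dominance_code o d ex2 ey2)
  (bind d.+1 (dominance_code o d.+1 ex1 ey1)
  (bind d.+2 (dominance_code o d.+2 ex1 ey2)
  (bind d.+3 (dominance_code o d.+3 ex2 ey1)
  (Assign d.+4 (Bin Sub (Bin Add (Reg d) (Reg d.+1))
                        (Bin Add (Reg d.+2) (Reg d.+3))))))).

Definition corner_code o d ex ey :=
  bind d (summation d (Bin Mod ex Eparam)
    (bind d.+2 (Assign d.+2 (Bin Add (Bin Mul (Bin Div ex Eparam) Eparam) (Reg d.+1)))
    (bind d.+3 (Assign d.+3 (Bin Add (Evalue o (Reg d.+2)) (Const 1)))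
      (box_code o d.+4 (Const 0) (Reg d.+2) (Reg d.+3) ey))))
  (Assign d.+1 (Bin Add
     (Fetch (Eaddr (corner_tag o) (Const 0) (Const 0) (Bin Div ex Eparam) ey)) (Reg d))).

(* [eP] holds [2 ^ k]. *)
Definition strip_code o d ek eP es ex1 ex2 :=
  bind d (Assign d (Bin Mul es eP))
  (bind d.+1 (Assign d.+1 (Bin Add (Reg d) eP))
  (bind d.+2 (box_code o d.+2 (Const 0) ex1 (Reg d) (Reg d.+1))
  (bind d.+3 (box_code o d.+3 (Const 0) ex2 (Reg d) (Reg d.+1))
  (bind d.+4 (Assign d.+4 (Bin Mul (Bin Div (Reg d.+2) Eparam) Eparam))
  (bind d.+5 (summation d.+5 (Bin Mod (Reg d.+2) Eparam)
     (bind d.+7 (Assign d.+7 (Fetch (Eaddr (sel_tag o) (Const 0) ek es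
                                       (Bin Add (Reg d.+4) (Reg d.+6)))))
     (bind d.+8 (Assign d.+8 (Evalue o (Reg d.+7)))
     (bind d.+9 (Assign d.+9 (Bin Add (Reg d.+7) (Const 1)))
       (box_code o d.+9.+1 (Reg d.+9) ex2 (Reg d) (Reg d.+8))))))
  (bind d.+6 (summation d.+6 (Bin Mod (Reg d.+2) Eparam)
     (bind d.+8 (Assign d.+8 (Fetch (Eaddr (sel_tag o) (Const 0) ek es
                                       (Bin Add (Reg d.+4) (Reg d.+7)))))
     (bind d.+9 (Assign d.+9 (Bin Add (Evalue o (Reg d.+8)) (Const 1)))
       (box_code o d.+9.+1 (Const 0) (Reg d.+8) (Reg d.+9) (Reg d.+1)))))
  (Assign d.+7 (Bin Sub (Bin Add (Fetch (Eaddr (cross_tag o) ek es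
         (Bin Div (Reg d.+2) Eparam) (Reg d.+3))) (Reg d.+5)) (Reg d.+6))))))))).

Definition cross_code o d ex1 ex2 ey :=
  summation d EK
    (bind d.+2 (pow_code d.+2 (Reg d.+1))
    (bind d.+3 (Assign d.+3 (Bin Div ey (Reg d.+2)))
    (If (Bin Mod (Reg d.+3) (Const 2))
      (bind d.+4 (Assign d.+4 (Bin Sub (Reg d.+3) (Const 1)))
      (bind d.+5 (strip_code o d.+5 (Reg d.+1) (Reg d.+2) (Reg d.+4) ex1 ex2)
      (bind d.+6 (Assign d.+6 (Bin Mul (Reg d.+4) (Reg d.+2)))
      (bind d.+7 (Assign d.+7 (Bin Mul (Reg d.+3) (Reg d.+2)))
      (bind d.+8 (box_code o d.+8 (Const 0) ex1 (Reg d.+6) (Reg d.+7))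
      (bind d.+9 (box_code o d.+9 ex1 ex2 (Const 0) (Reg d.+6))
      (Assign d.+9.+1 (Bin Add (Reg d.+5)
                               (Bin Mul (Reg d.+8) (Reg d.+9))))))))))
      (Assign d.+4 (Const 0))))).

(** Registers [d] to [d.+5] receive the terms that [desc_pairs_decomposition] adds, [d.+6] to [d.+9]
    those that it subtracts. *)
Definition desc_code d ex1 ex2 ey1 ey2 :=
  bind d (corner_code 0 d ex2 ey2)
  (bind d.+1 (corner_code 0 d.+1 ex1 ey1)
  (bind d.+2 (cross_code 0 d.+2 ex1 ex2 ey1)
  (bind d.+3 (cross_code 1 d.+3 ey1 ey2 ex1)
  (bind d.+4 (box_code 0 d.+4 (Const 0) ex1 ey1 ey2)
  (bind d.+5 (box_code 0 d.+5 ex1 ex2 (Const 0) ey1)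
  (bind d.+6 (corner_code 0 d.+6 ex1 ey2)
  (bind d.+7 (corner_code 0 d.+7 ex2 ey1)
  (bind d.+8 (cross_code 0 d.+8 ex1 ex2 ey2)
  (bind d.+9 (cross_code 1 d.+9 ey1 ey2 ex2)
  (Assign d.+9.+1
    (Bin Sub (Bin Add (Bin Add (Bin Add (Bin Add (Reg d) (Reg d.+1)) (Reg d.+2))
                (Reg d.+3)) (Bin Mul (Reg d.+4) (Reg d.+5)))
             (Bin Add (Bin Add (Bin Add (Reg d.+6) (Reg d.+7)) (Reg d.+8))
                (Reg d.+9))))))))))))).

Definition powT K := loopT K 10.
Definition dominanceT K := sumT K (sumT K (powT K + powT K + 400)).
Definition boxT K := 4 * dominanceT K + 100.
Definition cornerT K q := sumT q (boxT K + 400) + 400.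
Definition stripT K q := 2 * sumT q (boxT K + 400) + 2 * boxT K + 600.
Definition crossT K q := sumT K (powT K + stripT K q + 2 * boxT K + 400).
Definition descT K q := 4 * cornerT K q + 4 * crossT K q + 2 * boxT K + 100.

(** * Correctness and cost of the query programs *)

Section Query.
Variables (w n q L K B : nat).
Local Notation N := (2 * n + 2).
Hypotheses (n_gt0 : 0 < n) (q_gt0 : 0 < q) (q_le : q <= n).
(** [L] is the number of binary digits of [n]. The top of a strip can reach [2 ^ L] and exceed [n];
    the additional level in [K] keeps every ordinate up to [2 * n] below [2 ^ K]. [B] stands for the
    fourth power of [N], and as a variable it turns word bounds into linear inequalities. *)
Hypotheses (KE : K = L.+1) (L_gt : n < 2 ^ L) (L_le : 2 ^ L <= 2 * n).
Hypotheses (B_ge : N * N * N * N <= B) (B_lt : 1000 * B < 2 ^ w).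

Lemma N_le_B : N * N <= B /\ N <= B.
Proof. by nia. Qed.

Lemma nn_le_B : n * n + n + 10 <= 4 * B.
Proof. by have := N_le_B; nia. Qed.

Lemma K_le : K <= 2 * n.
Proof. by rewrite KE; apply: leq_trans L_le; apply: ltn_expl. Qed.

Lemma expK_lt k : k <= K -> 2 ^ k <= 4 * n.
Proof. by move=> h; apply: leq_trans (_ : 2 ^ K <= _); rewrite ?leq_pexp2l // KE expnS; lia. Qed.

(** [2 ^ L] is a multiple of [2 ^ k] that exceeds [v], so the strip containing [v] ends at or below
    it. *)
Lemma strip_top v k : v < n -> k < K -> (v %/ 2 ^ k).+1 * 2 ^ k <= 2 ^ L.
Proof.
move=> hv hk; have -> : L = (L - k) + k by lia.
rewrite expnD leq_mul2r; apply/orP; right.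
by rewrite ltn_divLR ?expn_gt0 // -expnD subnK // -ltnS; lia.
Qed.

Definition base (m : nat -> nat) :=
  [/\ m 0 = n, m (addr n 1 0 0 0 0) = q & m (addr n 1 0 0 0 1) = K].

Section Address.
Variable m : nat -> nat.
Hypothesis m0 : m 0 = n.

Lemma denotes_size G : denotes w m G En n.
Proof.
rewrite -m0; apply: denotes_fetch; apply: denotes_const.
by rewrite expn_gt0.
Qed.

Lemma denotes_EN G : denotes w m G EN N.
Proof.
have [_ hN] := N_le_B.
apply: denotes_eq; first apply: denotes_add; first apply: denotes_add.
- exact: denotes_size.
- exact: denotes_size.
- by lia.
- by apply: denotes_const; lia.
- by lia.
- by lia.
Qed.

Lemma denotes_addr G t ea eb ec ed a b c d :
  t <= 15 -> denotes w m G ea a -> denotes w m G eb b -> denotes w m G ec c ->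
  denotes w m G ed d -> a < N -> b < N -> c < N -> d < N ->
  denotes w m G (Eaddr t ea eb ec ed) (addr n t a b c d).
Proof.
move=> ht ha hb hc hd la lb lc ld.
have [N1 N2] := N_le_B.
(* One step of Horner's scheme with the bound it preserves. Starting from a tag below 16, four steps
   stay below 16 times the fourth power of [N]. *)
have step e e' u v b0 : denotes w m G e u -> denotes w m G e' v -> v < N ->
  u < b0 -> b0 * N < 2 ^ w -> denotes w m G (horner e e') (u * N + v) /\ u * N + v < b0 * N.
  move=> hu hv lv lu hb0; have lt : u * N + v < b0 * N by nia.
  split=> //; apply: denotes_add => //; last by lia.
  by apply: denotes_mul => //; [apply: denotes_EN | lia].
have h0 : denotes w m G (Const t) t by apply: denotes_const; lia.
have [h1 l1] := step _ _ t a 16 h0 ha la ltac:(lia) ltac:(lia).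
have [h2 l2] := step _ _ _ b _ h1 hb lb l1 ltac:(nia).
have [h3 l3] := step _ _ _ c _ h2 hc lc l2 ltac:(nia).
by have [h4 l4] := step _ _ _ d _ h3 hd ld l3 ltac:(nia).
Qed.

End Address.

Section Memory.
Variable m : nat -> nat.
Hypothesis m_base : base m.
Implicit Types (G : seq nat) (e : expr).

Lemma denotes_En G : denotes w m G En n.
Proof. by apply: denotes_size; case: m_base. Qed.

Lemma denotes_Eaddr G t ea eb ec ed a b c d :
  t <= 15 -> denotes w m G ea a -> denotes w m G eb b -> denotes w m G ec c ->
  denotes w m G ed d -> a < N -> b < N -> c < N -> d < N ->
  denotes w m G (Eaddr t ea eb ec ed) (addr n t a b c d).
Proof. by apply: denotes_addr; case: m_base. Qed.

Lemma denotes_Eparam G : denotes w m G Eparam q.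
Proof.
have [_ <- _] := m_base; apply: denotes_fetch.
by apply: denotes_Eaddr; try (apply: denotes_const); lia.
Qed.

Lemma denotes_EK G : denotes w m G EK K.
Proof.
have [_ _ <-] := m_base; apply: denotes_fetch.
by apply: denotes_Eaddr; try (apply: denotes_const); lia.
Qed.


Lemma computes_assign G e v :
  denotes w m G e v -> computes w m G (Assign (size G) e) v (ecost e).+1.
Proof. by move=> h; apply: computes_expr. Qed.

Ltac small := try (solve [clear B_ge; first [lia
  | unfold val_tag, cell_tag, sel_tag, cross_tag, corner_tag; simpl; lia]]).

Ltac den :=
  lazymatch goal with
  | |- denotes _ _ _ (Const _) _ => apply: denotes_const; small
  | |- denotes _ _ _ Eparam _ => apply: denotes_Eparam
  | |- denotes _ _ _ EK _ => apply: denotes_EK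
  | |- denotes _ _ _ En _ => apply: denotes_En
  | |- denotes _ _ _ (Evalue _ _) _ => unfold Evalue; den
  | |- denotes _ _ _ (Fetch (Eaddr _ _ _ _ _)) _ =>
      eapply denotes_fetch;
      eapply denotes_Eaddr; [small|den|den|den|den|small|small|small|small]
  | |- denotes _ _ _ (Bin Add _ _) _ => eapply denotes_add; [den|den|small]
  | |- denotes _ _ _ (Bin Mul _ _) _ => eapply denotes_mul; [den|den|small]
  | |- denotes _ _ _ (Bin Sub _ _) _ => eapply denotes_sub; [den|den|small]
  | |- denotes _ _ _ (Bin Div _ _) _ => eapply denotes_div; [den|den|small]
  | |- denotes _ _ _ (Bin Mod _ _) _ => eapply denotes_mod; [den|den|small]
  | |- _ => first [eassumption | apply: denotes_top | apply: denotes_weaken; den]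
  end.

Lemma pow_spec G ek k :
  denotes w m G ek k -> ecost ek <= 10 -> k <= K ->
  computes w m G (pow_code (size G) ek) (2 ^ k) (powT K).
Proof.
move=> hk ck lk; have := nn_le_B; have := K_le => h1 h2.
apply: computes_eq; first apply: (computes_iterate (g := fun i => 2 ^ i)).
- exact: hk.
- by small.
- by apply: denotes_const; small.
- by lia.
- by [].
- move=> i hi; apply: computes_eq; first apply: computes_assign.
  + have e2 : 2 ^ i <= 4 * n by apply: expK_lt; lia.
    den.
  + by rewrite /= expnS; lia.
  + exact: leqnn.
- by [].
- exact: loopT_mono.
Qed.

Section Tables.
Variables (o : nat) (p : nat -> nat).
Hypothesis o_le : o <= 1.
Hypothesis p_lt : forall i, i < n -> p i < n.

Definition cell_table := forall k l a b, k < K -> l < K -> a < N -> b < N ->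
  m (addr n (cell_tag o) k l a b) = dyadic_cell n p k l a b.

Definition value_table := forall i, i < n -> m (addr n (val_tag o) 0 0 0 i) = p i.

(** Stated from a point to the cell of its rank, the direction in which the table is filled;
    [selectP] reads it from ranks to points. *)
Definition select_table := forall i k, i < n -> k < K ->
  m (addr n (sel_tag o) 0 k (p i %/ 2 ^ k)
       (box p 0 i (p i %/ 2 ^ k * 2 ^ k) ((p i %/ 2 ^ k).+1 * 2 ^ k))) = i.

Definition cross_table := forall k s g r, k < K -> s.+1 * 2 ^ k <= 2 ^ L ->
  g <= n %/ q -> r <= box p 0 n (s * 2 ^ k) (s.+1 * 2 ^ k) ->
  m (addr n (cross_tag o) k s g r) =
  rank_cross_inv n p (s * 2 ^ k) (s.+1 * 2 ^ k) (g * q) r.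

Definition corner_table := forall b y, b <= n %/ q -> y <= n ->
  m (addr n (corner_tag o) 0 0 b y) = corner_inv p (b * q) y.

Lemma dominance_le x y : dominance p x y <= x.
Proof. by rewrite -{2}[x]subn0; apply: sum_bool_size. Qed.

Lemma dominance_spec G ex ey x y : cell_table ->
  denotes w m G ex x -> denotes w m G ey y -> ecost ex <= 10 -> ecost ey <= 10 ->
  x <= n -> y <= 2 * n ->
  computes w m G (dominance_code o (size G) ex ey) (dominance p x y) (dominanceT K).
Proof.
move=> hc hx hy cx cy lx ly; have := nn_le_B; have := K_le => h1 h2.
have hK : 2 ^ K = 2 * 2 ^ L by rewrite KE expnS.
(* The bound [x] on the total, rewritten as the double sum, keeps the inner and outer sums within a
   word. *)
have := dominance_le x y; rewrite (@dominance_dyadic K n); try lia.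
move=> hd; apply: computes_summation.
- exact: denotes_EK.
- by small.
- by [].
- by apply: leq_ltn_trans hd _; small.
move=> k a hk; apply: computes_summation.
- exact: denotes_EK.
- by small.
- by [].
- apply: leq_ltn_trans (leq_trans _ hd) _; last small.
  by rewrite [leqRHS](bigD1_seq k) /= ?mem_index_iota ?iota_uniq ?leq_addr.
move=> l b hl; have pk := expK_lt (ltnW hk); have pl := expK_lt (ltnW hl).
have dk := leq_div y (2 ^ k); have dl := leq_div x (2 ^ l).
have mm : (y %/ 2 ^ k) %% 2 * ((x %/ 2 ^ l) %% 2) <= 1.
  by rewrite !modn2 mulnb; case: (_ && _).
apply: computes_eq; first apply: computes_bind.
- by apply: pow_spec; [den | by [] | lia].
- apply: computes_bind; first by apply: pow_spec; [den | by [] | lia].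
  apply: (computes_if (T := 200)); first den.
  + move=> _; apply: computes_eq; first apply: computes_assign; first den.
    * by rewrite !subn1; apply: hc => //; lia.
    * by rewrite /=; lia.
  + by move=> _; apply: computes_expr => //; den.
- by [].
- by rewrite /=; lia.
Qed.

Lemma box_spec G ex1 ex2 ey1 ey2 x1 x2 y1 y2 : cell_table ->
  denotes w m G ex1 x1 -> denotes w m G ex2 x2 ->
  denotes w m G ey1 y1 -> denotes w m G ey2 y2 ->
  ecost ex1 <= 10 -> ecost ex2 <= 10 -> ecost ey1 <= 10 -> ecost ey2 <= 10 ->
  x1 <= n -> x2 <= n -> y1 <= 2 * n -> y2 <= 2 * n -> (x1 <= x2) || (y1 <= y2) ->
  computes w m G (box_code o (size G) ex1 ex2 ey1 ey2) (box p x1 x2 y1 y2) (boxT K).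
Proof.
move=> hc hx1 hx2 hy1 hy2 cx1 cx2 cy1 cy2 lx1 lx2 ly1 ly2 h.
have nB := nn_le_B.
have d1 := dominance_le x1 y1; have d2 := dominance_le x1 y2.
have d3 := dominance_le x2 y1; have d4 := dominance_le x2 y2.
apply: computes_eq; first apply: computes_bind.
- by apply: (dominance_spec (x := x2) (y := y2)) => //; den.
- apply: computes_bind.
    by apply: (dominance_spec (x := x1) (y := y1)) => //; den.
  apply: computes_bind.
    by apply: (dominance_spec (x := x1) (y := y2)) => //; den.
  apply: computes_bind.
    by apply: (dominance_spec (x := x2) (y := y1)) => //; den.
  by apply: computes_assign; den.
- by rewrite box_dominance.
- by rewrite /boxT /=; lia.
Qed.

Ltac boxs := eapply box_spec;
  [eassumption|den|den|den|den|small|small|small|small|small|small|small|small|small].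

Lemma box_le_n x1 x2 y1 y2 : x2 <= n -> box p x1 x2 y1 y2 <= n.
Proof. by move=> h; apply: leq_trans (box_size _ _ _ _ _) _; lia. Qed.

Lemma corner_spec G ex ey x y : cell_table -> value_table -> corner_table ->
  denotes w m G ex x -> denotes w m G ey y -> ecost ex <= 10 -> ecost ey <= 10 ->
  x <= n -> y <= n ->
  computes w m G (corner_code o (size G) ex ey) (corner_inv p x y) (cornerT K q).
Proof.
move=> hc hv hi hx hy cx cy lx ly; have nB := nn_le_B.
have xE := divn_eq x q; have xr := ltn_pmod x q_gt0; have xd := leq_div x q.
have xdn : x %/ q <= n %/ q by apply: leq_div2r.
have tot : corner_inv p x y = corner_inv p (x %/ q * q) y +
    \sum_(0 <= t < x %% q) box p 0 (x %/ q * q + t) (p (x %/ q * q + t)).+1 y.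
  by rewrite {1}xE corner_inv_walk.
have le1 := corner_inv_le p x y.
have le2 : x * x <= n * n by apply: leq_mul.
apply: computes_eq; first apply: computes_bind.
- apply: (computes_summation
    (f := fun t => box p 0 (x %/ q * q + t) (p (x %/ q * q + t)).+1 y)
    (T := boxT K + 400)).
  + by den.
  + by small.
  + by rewrite /=; lia.
  + by small.
  move=> t a ht.
  have ltx : x %/ q * q + t < n by lia.
  have lp := p_lt ltx.
  apply: computes_eq; first apply: computes_bind.
  + by apply: computes_assign; den.
  + apply: computes_bind.
      apply: computes_eq; first apply: computes_assign; first den.
      * by rewrite hv; lia.
      * by rewrite hv // addn1.
      * exact: leqnn.
    by boxs.
  + by rewrite addn1.
  + by rewrite /=; lia.
- apply: computes_assign; den; rewrite hi //; small.
- by rewrite tot hi //.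
- have := @sumT_mono (x %% q) q (boxT K + 400) (boxT K + 400).
  by rewrite /cornerT /=; lia.
Qed.

Lemma sum_box_le r (f : nat -> nat) : r <= n -> (forall t, t < r -> f t <= n) ->
  \sum_(0 <= t < r) f t <= n * n.
Proof.
move=> hr hf; apply: leq_trans (_ : \sum_(0 <= t < r) n <= _).
  by rewrite big_nat [leqRHS]big_nat; apply: leq_sum => t /hf.
by rewrite sum_nat_const_nat subn0 leq_mul2r hr orbT.
Qed.

(** Some point of strip [s] has rank [t], and the table is known to hold exactly that point in the
    cell of its strip and rank. *)
Lemma selectP k s x t : select_table -> k < K -> x <= n ->
  t < box p 0 x (s * 2 ^ k) (s.+1 * 2 ^ k) ->
  let e := m (addr n (sel_tag o) 0 k s t) in
  [/\ e < x, s * 2 ^ k <= p e < s.+1 * 2 ^ k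
    & box p 0 e (s * 2 ^ k) (s.+1 * 2 ^ k) = t].
Proof.
move=> hs hk hx /box_rank_ex [e [ex hp ht]].
have es : p e %/ 2 ^ k = s.
  apply/eqP; rewrite eqn_leq -ltnS ltn_divLR ?expn_gt0 //.
  by rewrite leq_divRL ?expn_gt0 // andbC.
suff -> : m (addr n (sel_tag o) 0 k s t) = e by split.
by have := hs e k (leq_trans ex hx) hk; rewrite es ht.
Qed.

Lemma strip_spec G ek eP es ex1 ex2 k s x1 x2 :
  cell_table -> value_table -> select_table -> cross_table ->
  denotes w m G ek k -> denotes w m G eP (2 ^ k) -> denotes w m G es s ->
  denotes w m G ex1 x1 -> denotes w m G ex2 x2 ->
  ecost ek <= 10 -> ecost eP <= 10 -> ecost es <= 10 ->
  ecost ex1 <= 10 -> ecost ex2 <= 10 ->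
  k < K -> s.+1 * 2 ^ k <= 2 ^ L -> x1 <= x2 -> x2 <= n ->
  computes w m G (strip_code o (size G) ek eP es ex1 ex2)
    (cross_inv p x1 x2 (s * 2 ^ k) (s.+1 * 2 ^ k)) (stripT K q).
Proof.
move=> hc hv hs ht dk dP ds d1 d2 ck cP cs c1 c2 lk lhi l12 l2.
have nB := nn_le_B; have Kn := K_le.
have hiE : s.+1 * 2 ^ k = s * 2 ^ k + 2 ^ k by rewrite mulSn addnC.
have lo_le : s <= s * 2 ^ k by rewrite leq_pmulr // expn_gt0.
have pk : 0 < 2 ^ k by rewrite expn_gt0.
have sel t := @selectP k s x1 t hs lk (leq_trans l12 l2).
move: ht => /(_ k s _ _ lk lhi) ht.
pose e t := m (addr n (sel_tag o) 0 k s t).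
(* The limits and the height of the strip become variables, so that [lia] meets linear goals. *)
move: lhi hiE sel ht lo_le pk dP.
move: (s.+1 * 2 ^ k) => hi; move loE: (s * 2 ^ k) => lo.
move: (2 ^ k) loE => P loE lhi hiE sel ht lo_le pk dP.
have b1 := box_size p 0 x1 lo hi; have b2 := box_size p 0 x2 lo hi.
have r1q := divn_eq (box p 0 x1 lo hi) q.
have r1m := ltn_pmod (box p 0 x1 lo hi) q_gt0.
have r1d := leq_div (box p 0 x1 lo hi) q.
have r1n : box p 0 x1 lo hi %/ q <= n %/ q by apply: leq_div2r; lia.
have r2n := box_mono p lo hi l2.
set r1 := box p 0 x1 lo hi in b1 r1q r1m r1d r1n sel.
set r2 := box p 0 x2 lo hi in b2 r2n.
pose plus t := box p (e (r1 %/ q * q + t)).+1 x2 lo (p (e (r1 %/ q * q + t))).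
pose minus t := box p 0 (e (r1 %/ q * q + t)) (p (e (r1 %/ q * q + t))).+1 hi.
(* The walk runs from the last stored rank at or below [r1] up to [r1]; the program returns the
   stored value plus gains minus losses. *)
have walk : cross_inv p x1 x2 lo hi + \sum_(0 <= t < r1 %% q) minus t =
    rank_cross_inv n p lo hi (r1 %/ q * q) r2 + \sum_(0 <= t < r1 %% q) plus t.
  apply: cross_inv_walk => // t; rewrite -r1q => htr.
  by have [_ ? ?] := sel t htr.
have facts t : t < r1 %% q -> [/\ r1 %/ q * q + t < n, e (r1 %/ q * q + t) < x1
    & lo <= p (e (r1 %/ q * q + t)) < hi].
  by move=> htr; have [|? ? ?] := sel (r1 %/ q * q + t); [lia | split=> //; lia].
have plusB : \sum_(0 <= t < r1 %% q) plus t <= n * n.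
  by apply: sum_box_le => [|t _]; [lia | apply: box_le_n].
have minusB : \sum_(0 <= t < r1 %% q) minus t <= n * n.
  by apply: sum_box_le => [|t /facts [_ h _]]; [lia | apply: box_le_n; lia].
have crossB := rank_cross_inv_le p n lo hi (r1 %/ q * q) r2.
apply: computes_eq; first apply: computes_bind.
- by apply: computes_assign; den.
- rewrite loE; apply: computes_bind; first by apply: computes_assign; den.
  rewrite -hiE; apply: computes_bind; first by boxs.
  apply: computes_bind; first by boxs.
  rewrite -/r1 -/r2; apply: computes_bind; first by apply: computes_assign; den.
  apply: computes_bind.
    apply: (computes_summation (f := plus) (T := boxT K + 400)).
    + by den.
    + by small.
    + by [].
    + by small.
    move=> t a /facts [f1 f2 f3].
    apply: computes_eq; first apply: computes_bind.
    * by apply: computes_assign; den.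
    * rewrite -/(e _); apply: computes_bind.
        apply: (computes_eq (v' := p (e (r1 %/ q * q + t)))).
        - by apply: computes_assign; den.
        - by rewrite hv //; lia.
        - exact: leqnn.
      apply: computes_bind; first by apply: computes_assign; den.
      by boxs.
    * by rewrite /plus addn1.
    * by rewrite /=; lia.
  apply: computes_bind.
    apply: (computes_summation (f := minus) (T := boxT K + 400)).
    + by den.
    + by small.
    + by [].
    + by small.
    move=> t a /facts [f1 f2 f3].
    apply: computes_eq; first apply: computes_bind.
    * by apply: computes_assign; den.
    * rewrite -/(e _); apply: computes_bind.
        apply: (computes_eq (v' := (p (e (r1 %/ q * q + t))).+1)).
        - by apply: computes_assign; den; rewrite hv; small.
        - by rewrite hv; lia.
        - exact: leqnn.
      by boxs.
    * by [].
    * by rewrite /=; lia.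
  by apply: computes_assign; den; rewrite ht //; small.
- by rewrite ht //; lia.
- have := @sumT_mono (r1 %% q) q (boxT K + 400) (boxT K + 400).
  by rewrite /stripT /=; lia.
Qed.

Lemma cross_spec G ex1 ex2 ey x1 x2 y :
  cell_table -> value_table -> select_table -> cross_table ->
  denotes w m G ex1 x1 -> denotes w m G ex2 x2 -> denotes w m G ey y ->
  ecost ex1 <= 10 -> ecost ex2 <= 10 -> ecost ey <= 10 ->
  x1 <= x2 -> x2 <= n -> y <= n ->
  computes w m G (cross_code o (size G) ex1 ex2 ey)
    (cross_inv p x1 x2 0 y) (crossT K q).
Proof.
move=> hc hv hs ht d1 d2 dy c1 c2 cy l12 l2 ly.
have nB := nn_le_B; have Kn := K_le.
have tot := cross_inv_le p x1 x2 0 y.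
have xx : x1 * x2 <= n * n by apply: leq_mul; lia.
have yK : y < 2 ^ K by rewrite KE expnS; lia.
rewrite (cross_inv_dyadic _ _ _ yK) in tot *.
apply: computes_summation.
- exact: denotes_EK.
- by small.
- by [].
- by small.
move=> k a hk; have pk := expK_lt (ltnW hk); have Yle := leq_div y (2 ^ k).
have YP : y %/ 2 ^ k * 2 ^ k <= y := leq_divM _ _.
set Y := y %/ 2 ^ k in Yle YP *.
(* With bit [k] set, the strip of this level is the one numbered [Y - 1]. *)
have loE : y %/ 2 ^ k.+1 * 2 ^ k.+1 = (Y - Y %% 2) * 2 ^ k.
  rewrite expnSr divnMA -/Y mulnA mulnAC; congr (_ * _).
  by rewrite {2}(divn_eq Y 2) addnK.
rewrite loE.
have Ym : Y %% 2 <= 1 by rewrite -ltnS ltn_pmod.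
have YmY := leq_mod Y 2.
have b1 := @box_le_n 0 x1 ((Y - 1) * 2 ^ k) (Y * 2 ^ k) (leq_trans l12 l2).
have b2 := @box_le_n x1 x2 0 ((Y - 1) * 2 ^ k) l2.
have b12 := leq_mul b1 b2.
have cs := cross_inv_le p x1 x2 ((Y - 1) * 2 ^ k) (Y * 2 ^ k).
have lo_le : (Y - 1) * 2 ^ k <= Y * 2 ^ k by rewrite leq_mul2r leq_subr orbT.
apply: computes_eq; first apply: computes_bind.
- by apply: pow_spec; [den | by [] | lia].
- apply: computes_bind; first by apply: computes_assign; den.
  rewrite -/Y; apply: (computes_if (T := stripT K q + 2 * boxT K + 200)).
  + by den.
  + move=> Y1; have Ypos : (Y - 1).+1 = Y by lia.
    apply: computes_eq; first apply: computes_bind.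
    * by apply: computes_assign; den.
    * apply: computes_bind.
        eapply strip_spec; [eassumption|eassumption|eassumption|eassumption
          |den|den|den|den|den|by []|by []|by []|lia|lia|lia| |lia|lia].
        by rewrite Ypos; lia.
      rewrite Ypos; apply: computes_bind; first by apply: computes_assign; den.
      apply: computes_bind; first by apply: computes_assign; den.
      apply: computes_bind; first by boxs.
      apply: computes_bind; first by boxs.
      by apply: computes_assign; den.
    * by [].
    * by rewrite /=; lia.
  + move=> _; apply: computes_expr; first by den.
    by rewrite /=; lia.
(* With bit [k] equal to 0 the strip is empty and both summands vanish, in accordance with the 0 of
   the program. *)
- case: eqP => h /=; last by have -> : Y %% 2 = 1 by lia.
  have z : box p 0 x1 (Y * 2 ^ k) (Y * 2 ^ k) = 0.
    by rewrite /box big1 // => i _; lia.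
  have z' : cross_inv p x1 x2 (Y * 2 ^ k) (Y * 2 ^ k) = 0.
    by rewrite /cross_inv big1 // => i _; rewrite big1 // => j _; lia.
  by rewrite h subn0 z z'.
- by rewrite /=; lia.
Qed.

End Tables.

Record tables o p : Prop := Tables {
  tables_value : value_table o p;
  tables_cell : cell_table o p;
  tables_select : select_table o p;
  tables_cross : cross_table o p;
  tables_corner : corner_table o p }.

Lemma desc_spec G p pv ex1 ex2 ey1 ey2 x1 x2 y1 y2 :
  (forall i, i < n -> p i < n) -> (forall i, i < n -> pv i < n) ->
  (forall i, i < n -> pv (p i) = i) -> (forall i, i < n -> p (pv i) = i) ->
  tables 0 p -> tables 1 pv ->
  denotes w m G ex1 x1 -> denotes w m G ex2 x2 ->
  denotes w m G ey1 y1 -> denotes w m G ey2 y2 ->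
  ecost ex1 <= 10 -> ecost ex2 <= 10 -> ecost ey1 <= 10 -> ecost ey2 <= 10 ->
  x1 <= x2 -> x2 <= n -> y1 <= y2 -> y2 <= n ->
  computes w m G (desc_code (size G) ex1 ex2 ey1 ey2)
    (desc_pairs p x1 x2 y1 y2) (descT K q).
Proof.
move=> lp lpv pK pvK [hv hc hs ht hk] [hv' hc' hs' ht' hk'].
move=> d1 d2 d3 d4 c1 c2 c3 c4 lx lxn ly lyn.
have nB := nn_le_B.
have B1 := desc_pairs_le p x1 x2 y1 y2.
have B2 := corner_inv_le p x1 y2; have B3 := corner_inv_le p x2 y1.
have B4 := corner_inv_le p x2 y2; have B5 := corner_inv_le p x1 y1.
have B6 := cross_inv_le p x1 x2 0 y2; have B7 := cross_inv_le p x1 x2 0 y1.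
have B8 := cross_inv_le pv y1 y2 0 x2; have B9 := cross_inv_le pv y1 y2 0 x1.
have S1 : x1 * x2 <= n * n by apply: leq_mul; lia.
have S2 : x1 * x1 <= n * n by apply: leq_mul; lia.
have S3 : x2 * x2 <= n * n by apply: leq_mul; lia.
have S4 : y1 * y2 <= n * n by apply: leq_mul; lia.
have S5 : box p 0 x1 y1 y2 * box p x1 x2 0 y1 <= n * n.
  by apply: leq_mul; apply: leq_trans (box_size _ _ _ _ _) _; lia.
have main := desc_pairs_decomposition lp lpv pK pvK lx lxn ly lyn.
have x1n : x1 <= n by lia.
have y1n : y1 <= n by lia.
apply: computes_eq; first apply: computes_bind.
- by apply: (corner_spec (o := 0) (p := p) isT lp (x := x2) (y := y2)) => //; den.
- apply: computes_bind.
    by apply: (corner_spec (o := 0) (p := p) isT lp (x := x1) (y := y1)) => //; den.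
  apply: computes_bind.
    by apply: (cross_spec (o := 0) (p := p) isT (x1 := x1) (x2 := x2) (y := y1)) => //; den.
  apply: computes_bind.
    by apply: (cross_spec (o := 1) (p := pv) isT (x1 := y1) (x2 := y2) (y := x1)) => //; den.
  apply: computes_bind.
    by apply: (box_spec (o := 0) (p := p) isT (x1 := 0) (x2 := x1)
      (y1 := y1) (y2 := y2)) => //; try lia; den.
  apply: computes_bind.
    by apply: (box_spec (o := 0) (p := p) isT (x1 := x1) (x2 := x2)
      (y1 := 0) (y2 := y1)) => //; try lia; den.
  apply: computes_bind.
    by apply: (corner_spec (o := 0) (p := p) isT lp (x := x1) (y := y2)) => //; den.
  apply: computes_bind.
    by apply: (corner_spec (o := 0) (p := p) isT lp (x := x2) (y := y1)) => //; den.
  apply: computes_bind.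
    by apply: (cross_spec (o := 0) (p := p) isT (x1 := x1) (x2 := x2) (y := y2)) => //; den.
  apply: computes_bind.
    by apply: (cross_spec (o := 1) (p := pv) isT (x1 := y1) (x2 := y2) (y := x2)) => //; den.
  by apply: computes_assign; den.
- by lia.
- by rewrite /descT /=; lia.
Qed.

Definition tail_code (dir : direction) :=
  if dir is Ascending then
    bind 7 (box_code 0 7 (Reg 4) (Reg 1) (Reg 5) (Reg 3))
      (Assign 8 (Bin Sub (Bin Div (Bin Sub (Bin Mul (Reg 7) (Reg 7)) (Reg 7))
                                  (Const 2)) (Reg 6)))
  else Assign 7 (Reg 6).

Definition query_code (dir : direction) :=
  Seq (bind 4 (Assign 4 (Bin Sub (Reg 0) (Const 1)))
      (bind 5 (Assign 5 (Bin Sub (Reg 2) (Const 1)))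
      (bind 6 (desc_code 6 (Reg 4) (Reg 1) (Reg 5) (Reg 3))
      (tail_code dir))))
    (Assign 0 (Reg 4)).

Definition queryT := descT K q + boxT K + 200.

(** The conclusion [mem s = m] is what allows any number of queries in succession. *)
Lemma query_spec dir p pv x1 x2 y1 y2 :
  (forall i, i < n -> p i < n) -> (forall i, i < n -> pv i < n) ->
  (forall i, i < n -> pv (p i) = i) -> (forall i, i < n -> p (pv i) = i) ->
  tables 0 p -> tables 1 pv ->
  0 < x1 -> x1 <= x2 -> x2 <= n -> 0 < y1 -> y1 <= y2 -> y2 <= n ->
  exists t s,
    [/\ exec w (query_code dir) (State (args [:: x1; x2; y1; y2]) m) t s,
        regs s 0 = (if dir is Ascending then asc_pairs else desc_pairs)
                     p x1.-1 x2 y1.-1 y2,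
        mem s = m & t <= queryT].
Proof.
move=> lp lpv pK pvK h0 h1 x1_gt0 lx lxn y1_gt0 ly lyn.
have nB := nn_le_B.
have inj : {in gtn n &, injective p}.
  by move=> i j; rewrite !inE => hi hj h; rewrite -(pK _ hi) h pK.
have B1 := desc_pairs_le p (x1 - 1) x2 (y1 - 1) y2.
have B2 := box_size p (x1 - 1) x2 (y1 - 1) y2.
have B3 : (x2 - (x1 - 1)) * (x2 - (x1 - 1)) <= n * n by apply: leq_mul; lia.
have B4 : box p (x1 - 1) x2 (y1 - 1) y2 * box p (x1 - 1) x2 (y1 - 1) y2 <= n * n.
  by apply: leq_mul; lia.
have B5 := leq_div (box p (x1 - 1) x2 (y1 - 1) y2 * box p (x1 - 1) x2 (y1 - 1) y2
                    - box p (x1 - 1) x2 (y1 - 1) y2) 2.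
(* A stack is listed from its top register down, in the reverse of the argument order. *)
pose G := [:: y2; y1; x2; x1].
pose D := desc_pairs p (x1 - 1) x2 (y1 - 1) y2.
have tail : computes w m [:: D, y1 - 1, x1 - 1 & G] (tail_code dir)
    ((if dir is Ascending then asc_pairs else desc_pairs) p (x1 - 1) x2 (y1 - 1) y2)
    (boxT K + 50).
  case: dir => /=; last first.
    by apply: (computes_expr (G := [:: D, y1 - 1, x1 - 1 & G])); [den | rewrite /=; lia].
  apply: computes_eq; first apply: (computes_bind (G := [:: D, y1 - 1, x1 - 1 & G])).
  - case: h0 => _ hc _ _ _.
    by apply: (box_spec (o := 0) (p := p) isT (G := [:: D, y1 - 1, x1 - 1 & G])
      (x1 := x1 - 1) (x2 := x2) (y1 := y1 - 1) (y2 := y2)) => //; try lia; den.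
  - by apply: (computes_assign (G := [:: _, D, y1 - 1, x1 - 1 & G])); den.
  - by symmetry; apply: asc_pairs_desc_pairs lxn inj.
  - by rewrite /=; lia.
have : computes w m G (bind 4 (Assign 4 (Bin Sub (Reg 0) (Const 1)))
      (bind 5 (Assign 5 (Bin Sub (Reg 2) (Const 1)))
      (bind 6 (desc_code 6 (Reg 4) (Reg 1) (Reg 5) (Reg 3)) (tail_code dir))))
    ((if dir is Ascending then asc_pairs else desc_pairs) p x1.-1 x2 y1.-1 y2)
    (descT K q + boxT K + 100).
  apply: computes_eq; first apply: (computes_bind (G := G)).
  - by apply: (computes_assign (G := G)); den.
  - apply: (computes_bind (G := x1 - 1 :: G)).
      by apply: (computes_assign (G := x1 - 1 :: G)); den.
    apply: (computes_bind (G := [:: y1 - 1, x1 - 1 & G])); last exact: tail.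
    by apply: (desc_spec (G := [:: y1 - 1, x1 - 1 & G]) lp lpv pK pvK h0 h1) => //;
      try lia; den.
  - by rewrite !subn1.
  - by rewrite /=; lia.
move=> /(_ (State (args [:: x1; x2; y1; y2]) m) erefl).
case; first by [].
move=> t [s [h e1 e2 e3 e4]].
eexists _, _; split.
- by apply: ExecSeq h _; apply: ExecAssign.
- by rewrite /= upd_same.
- by [].
- by rewrite /queryT /=; lia.
Qed.

End Memory.

(** * Initialisation *)

Ltac small := try (solve [clear B_ge; first [lia
  | unfold val_tag, cell_tag, sel_tag, cross_tag, corner_tag; simpl; lia]]).

Ltac den :=
  lazymatch goal with
  | |- denotes _ _ _ (Const _) _ => apply: denotes_const; small
  | |- denotes _ _ _ Eparam _ => eapply denotes_Eparam; eassumption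
  | |- denotes _ _ _ EK _ => eapply denotes_EK; eassumption
  | |- denotes _ _ _ En _ => eapply denotes_En; eassumption
  | |- denotes _ _ _ (Evalue _ _) _ => unfold Evalue; den
  | |- denotes _ _ _ (Eaddr _ _ _ _ _) _ =>
      eapply denotes_Eaddr;
      [eassumption|small|den|den|den|den|small|small|small|small]
  | |- denotes _ _ _ (Fetch _) _ => eapply denotes_fetch; den
  | |- denotes _ _ _ (Bin Add _ _) _ => eapply denotes_add; [den|den|small]
  | |- denotes _ _ _ (Bin Mul _ _) _ => eapply denotes_mul; [den|den|small]
  | |- denotes _ _ _ (Bin Sub _ _) _ => eapply denotes_sub; [den|den|small]
  | |- denotes _ _ _ (Bin Div _ _) _ => eapply denotes_div; [den|den|small]
  | |- denotes _ _ _ (Bin Mod _ _) _ => eapply denotes_mod; [den|den|small]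
  | |- _ => first [eassumption | apply: denotes_top | apply: denotes_weaken; den]
  end.

Lemma digits_inj u v u' v' : v < N -> v' < N ->
  u * N + v = u' * N + v' -> u = u' /\ v = v'.
Proof.
move=> hv hv' E; have N0 : 0 < N by rewrite addn2.
have := congr1 (divn^~ N) E; have := congr1 (modn^~ N) E.
by rewrite !modnMDl !divnMDl // !modn_small // !divn_small // !addn0.
Qed.

Lemma upd_addr m t a b c d t' a' b' c' d' v :
  a < N -> b < N -> c < N -> d < N -> a' < N -> b' < N -> c' < N -> d' < N ->
  upd m (addr n t a b c d) v (addr n t' a' b' c' d') =
  if [&& t' == t, a' == a, b' == b, c' == c & d' == d] then v
  else m (addr n t' a' b' c' d').
Proof.
move=> ha hb hc hd ha' hb' hc' hd'; rewrite /upd; congr (if _ then _ else _).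
apply/eqP/and5P => [|[/eqP -> /eqP -> /eqP -> /eqP -> /eqP ->] //].
move=> /digits_inj [] // /digits_inj [] // /digits_inj [] // /digits_inj [] //.
by move=> -> -> -> -> ->.
Qed.

(** A frame condition on whole blocks. The low cells belong to block 0, as cell [d] is
    [addr n 0 0 0 0 d], so the stored [n] and the input are framed too. *)
Definition outside (ts : seq nat) (m m' : nat -> nat) :=
  forall t a b c d, t \notin ts -> a < N -> b < N -> c < N -> d < N ->
  m' (addr n t a b c d) = m (addr n t a b c d).

(** Cell populations are incremented from 0, and the entries of ordinate 0 or second rank 0 in the
    corner and crossing tables are never written: their correct value is the initial 0. *)
Definition fresh t (m : nat -> nat) :=
  forall a b c d, a < N -> b < N -> c < N -> d < N -> m (addr n t a b c d) = 0.

Lemma outside_refl ts m : outside ts m m.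
Proof. by []. Qed.

Lemma outside_trans ts1 ts2 m1 m2 m3 :
  outside ts1 m1 m2 -> outside ts2 m2 m3 -> outside (ts1 ++ ts2) m1 m3.
Proof.
move=> h1 h2 t a b c d; rewrite mem_cat negb_or => /andP[t1 t2] ha hb hc hd.
by rewrite h2 ?h1.
Qed.

Lemma outside_upd t m m' a b c d v : a < N -> b < N -> c < N -> d < N ->
  outside [:: t] m m' -> outside [:: t] m (upd m' (addr n t a b c d) v).
Proof.
move=> ha hb hc hd h t' a' b' c' d'; rewrite inE => ht ? ? ? ?.
by rewrite upd_addr // (negbTE ht) /= h // inE.
Qed.

Lemma outside_base ts m m' : all (leq 2) ts -> outside ts m m' -> base m -> base m'.
Proof.
move=> /allP hts h [h1 h2 h3].
have h0 : m' (addr n 0 0 0 0 0) = m (addr n 0 0 0 0 0).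
  by apply: h => //; try lia; apply/negP => /hts.
by split; [rewrite -h1; apply: h0 | rewrite -h2; apply: h | rewrite -h3; apply: h];
  try lia; apply/negP => /hts.
Qed.

Lemma outside_fresh ts m m' t : t \notin ts -> outside ts m m' ->
  fresh t m -> fresh t m'.
Proof. by move=> ht h hf a b c d ? ? ? ?; rewrite h // hf. Qed.

Section OutsideTables.
Variables (ts : seq nat) (m m' : nat -> nat) (o : nat) (p : nat -> nat).
Hypothesis (mm' : outside ts m m') (p_lt : forall i, i < n -> p i < n).

Lemma outside_value : val_tag o \notin ts -> value_table m o p -> value_table m' o p.
Proof. by move=> ht h i hi; rewrite mm' ?h //; lia. Qed.

Lemma outside_cell : cell_tag o \notin ts -> cell_table m o p -> cell_table m' o p.
Proof. by move=> ht h k l a b *; have := K_le => ?; rewrite mm' ?h //; lia. Qed.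

Lemma outside_select : sel_tag o \notin ts -> select_table m o p -> select_table m' o p.
Proof.
move=> ht h i k hi hk; have := K_le => ?; have := p_lt hi => ?.
have := leq_div (p i) (2 ^ k).
have := box_size p 0 i (p i %/ 2 ^ k * 2 ^ k) ((p i %/ 2 ^ k).+1 * 2 ^ k).
by move=> ? ?; rewrite mm' ?h //; lia.
Qed.

Lemma outside_cross : cross_tag o \notin ts -> cross_table m o p -> cross_table m' o p.
Proof.
move=> ht h k s g r hk hs hg hr; have := K_le => ?.
have := box_size p 0 n (s * 2 ^ k) (s.+1 * 2 ^ k).
have := leq_div n q.
have : s.+1 <= s.+1 * 2 ^ k by rewrite leq_pmulr // expn_gt0.
by move=> ? ? ?; rewrite mm' ?h //; lia.
Qed.

Lemma outside_corner : corner_tag o \notin ts -> corner_table m o p -> corner_table m' o p.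
Proof. by move=> ht h b y *; have := leq_div n q => ?; rewrite mm' ?h //; lia. Qed.

End OutsideTables.

Definition cell_init o d :=
  for_loop d En (for_loop d.+1 EK (for_loop d.+2 EK
    (Seq (pow_code d.+3 (Reg d.+1))
    (Seq (pow_code d.+4 (Reg d.+2))
    (Seq (Assign d.+5 (Eaddr (cell_tag o) (Reg d.+1) (Reg d.+2)
            (Bin Div (Reg d) (Reg d.+4)) (Bin Div (Evalue o (Reg d)) (Reg d.+3))))
    (Store (Reg d.+5) (Bin Add (Fetch (Reg d.+5)) (Const 1)))))))).

Definition cell_initT := loopT n (loopT K (loopT K (2 * powT K + 300))).

Lemma cell_init_spec m G o p : o <= 1 -> (forall i, i < n -> p i < n) ->
  base m -> value_table m o p -> fresh (cell_tag o) m ->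
  runs w m G (cell_init o (size G))
    (fun m' => outside [:: cell_tag o] m m' /\ cell_table m' o p) cell_initT.
Proof.
move=> o_le p_lt hb hv hf; have nB := nn_le_B; have Kn := K_le.
pose hit (i k l a b : nat) := (i %/ 2 ^ l == a) && (p i %/ 2 ^ k == b).
(* The points before [i] are entered at all levels, the point [i] only at the pairs of levels
   lexicographically before [(k, l)]. *)
pose I i k l m' := outside [:: cell_tag o] m m' /\
  forall k' l' a b, k' < K -> l' < K -> a < N -> b < N ->
  m' (addr n (cell_tag o) k' l' a b) = \sum_(0 <= j < i) hit j k' l' a b +
    (((k' < k) || (k' == k) && (l' < l)) && hit i k' l' a b).
have Ib i k l m' : I i k l m' -> base m'.
  by move=> [h _]; apply: outside_base h hb; rewrite /= /cell_tag.
apply: runs_impl; first apply: (runs_for (b := n) (I := fun i => I i 0 0)).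
- by small.
- by [].
- split; first exact: outside_refl.
  by move=> k l a b hk hl ha hb'; rewrite big_geq //= add0n ltn0 andbF hf //; lia.
- by move=> i m' /Ib hb'; den.
- move=> i m' hi hI; apply: runs_impl; first apply: (runs_for (b := K) (I := fun k => I i k 0)).
  + by small.
  + by [].
  + exact: hI.
  + by move=> k m2 /Ib hb'; den.
  + move=> k m2 hk hI2; apply: runs_impl; first apply:
      (runs_for (b := K) (I := fun l => I i k l) (T := 2 * powT K + 300)).
    * by small.
    * by [].
    * exact: hI2.
    * by move=> l m3 /Ib hb'; den.
    * move=> l m3 hl hI3; have hb3 := Ib _ _ _ _ hI3; case: hI3 => ho hI3.
      have hv3 : value_table m3 o p.
        by apply: outside_value ho _ hv; rewrite inE /val_tag /cell_tag; lia.
      have pi := p_lt _ hi.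
      have d1 := leq_div i (2 ^ l); have d2 := leq_div (p i) (2 ^ k).
      have cellB : m3 (addr n (cell_tag o) k l (i %/ 2 ^ l) (p i %/ 2 ^ k)) <= n.
        rewrite hI3; try lia; rewrite !ltnn andbF /= addn0.
        by apply: leq_trans (sum_bool_size _ _ _) _; lia.
      apply: runs_impl; first apply: runs_let.
      - by apply: pow_spec; [den | by [] | lia].
      - apply: runs_let; first by apply: pow_spec; [den | by [] | lia].
        apply: runs_let.
          apply: (computes_eq (v' :=
            addr n (cell_tag o) k l (i %/ 2 ^ l) (p i %/ 2 ^ k))).
          + by apply: computes_assign; den; rewrite hv3 //; small.
          + by rewrite hv3.
          + exact: leqnn.
        apply: (runs_store (T := 10) (Q := I i k l.+1)).
        + by den.
        + by den.
        + split; first by apply: outside_upd => //; lia.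
          move=> k' l' a b hk' hl' ha hb'; rewrite upd_addr //; try lia.
          rewrite eqxx /= hI3; try lia.
          rewrite hI3 // !ltnn andbF /= addn0.
          case: (ltngtP k' k) => [_|_|->] //=.
          rewrite [_ < l.+1]ltnS; case: (ltngtP l' l) => [_|_|->] //=.
          rewrite /hit [i %/ _ == _]eq_sym [p i %/ _ == _]eq_sym.
          case: (a =P _) => [->|_] /=; last by rewrite ?addn0.
          by case: (b =P _) => [->|_] /=; rewrite ?addn0.
        + by [].
      - by [].
      - by rewrite /=; lia.
    * move=> m3 [h1 h2]; split=> // k' l' a b hk' hl' ha hb'; rewrite h2 //.
      by congr (_ + nat_of_bool (_ && _)); lia.
    * exact: leqnn.
  + move=> m2 [h1 h2]; split=> // k' l' a b hk' hl' ha hb'; rewrite h2 //.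
    by rewrite hk' big_nat_recr //= !ltn0 andbF /= ?addn0.
  + exact: leqnn.
- move=> m' [h1 h2]; split=> // k l a b hk hl ha hb'; rewrite h2 //.
  by rewrite !ltn0 andbF /= ?addn0.
- exact: leqnn.
Qed.

Lemma denotes_lt m G e1 e2 a b :
  denotes w m G e1 a -> denotes w m G e2 b -> denotes w m G (Bin Lt e1 e2) (a < b).
Proof.
move=> h1 h2; have nB := nn_le_B; apply: (denotes_bin (o := Lt)) => //.
by rewrite /=; case: (a < b); small.
Qed.

Ltac boxs := eapply box_spec;
  [eassumption|eassumption|eassumption|den|den|den|den
  |small|small|small|small|small|small|small|small|small].

Definition select_init o d :=
  for_loop d EK (for_loop d.+1 En
    (Seq (pow_code d.+2 (Reg d))
    (Seq (Assign d.+3 (Bin Div (Evalue o (Reg d.+1)) (Reg d.+2)))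
    (Seq (Assign d.+4 (Bin Mul (Reg d.+3) (Reg d.+2)))
    (Seq (Assign d.+5 (Bin Add (Reg d.+4) (Reg d.+2)))
    (Seq (box_code o d.+6 (Const 0) (Reg d.+1) (Reg d.+4) (Reg d.+5))
    (Store (Eaddr (sel_tag o) (Const 0) (Reg d) (Reg d.+3) (Reg d.+6))
           (Reg d.+1)))))))).

Definition select_initT := loopT K (loopT n (powT K + boxT K + 400)).

Lemma select_init_spec m G o p : o <= 1 -> (forall i, i < n -> p i < n) ->
  base m -> value_table m o p -> cell_table m o p ->
  runs w m G (select_init o (size G))
    (fun m' => outside [:: sel_tag o] m m' /\ select_table m' o p) select_initT.
Proof.
move=> o_le p_lt hb hv hc; have nB := nn_le_B; have Kn := K_le.
pose rank k i := box p 0 i (p i %/ 2 ^ k * 2 ^ k) ((p i %/ 2 ^ k).+1 * 2 ^ k).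
have rankB k i : rank k i <= i by apply: leq_trans (box_size _ _ _ _ _) _; lia.
have divB k i : p i %/ 2 ^ k <= p i by apply: leq_div.
pose I k j m' := outside [:: sel_tag o] m m' /\
  forall i' k', i' < n -> k' < K -> (k' < k) || (k' == k) && (i' < j) ->
  m' (addr n (sel_tag o) 0 k' (p i' %/ 2 ^ k') (rank k' i')) = i'.
have Ib k j m' : I k j m' -> base m'.
  by move=> [h _]; apply: outside_base h hb; rewrite /= /sel_tag.
apply: runs_impl; first apply: (runs_for (b := K) (I := fun k => I k 0)).
- by small.
- by [].
- by split; [exact: outside_refl | move=> *; lia].
- by move=> k m' /Ib hb'; den.
- move=> k m' hk hI; apply: runs_impl; first apply:
    (runs_for (b := n) (I := fun j => I k j) (T := powT K + boxT K + 400)).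
  + by small.
  + by [].
  + exact: hI.
  + by move=> j m2 /Ib hb'; den.
  + move=> j m2 hj hI2; have hb2 := Ib _ _ _ hI2; case: hI2 => ho hI2.
    have hv2 : value_table m2 o p.
      by apply: outside_value ho _ hv; rewrite inE /val_tag /sel_tag; lia.
    have hc2 : cell_table m2 o p.
      by apply: outside_cell ho _ hc; rewrite inE /cell_tag /sel_tag; lia.
    have pj := p_lt _ hj; have top := strip_top pj hk; have dj := divB k j.
    have pk : 0 < 2 ^ k by rewrite expn_gt0.
    have hiE : (p j %/ 2 ^ k).+1 * 2 ^ k = p j %/ 2 ^ k * 2 ^ k + 2 ^ k.
      by rewrite mulSn addnC.
    have rj := rankB k j.
    apply: runs_impl; first apply: runs_let.
    * by apply: pow_spec; [den | by [] | lia].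
    * apply: runs_let.
        apply: (computes_eq (v' := p j %/ 2 ^ k)).
        - by apply: computes_assign; den; rewrite hv2 //; small.
        - by rewrite hv2.
        - exact: leqnn.
      apply: runs_let; first by apply: computes_assign; den.
      apply: runs_let; first by apply: computes_assign; den.
      rewrite -hiE; apply: runs_let; first by boxs.
      rewrite -/(rank k j); apply: (runs_store (T := 100) (Q := I k j.+1)).
      + by den.
      + by den.
      + split; first by apply: outside_upd => //; lia.
        move=> i' k' hi' hk' hd.
        have pi := p_lt _ hi'; have di := divB k' i'; have ri := rankB k' i'.
        rewrite upd_addr //; try lia.
        (* No earlier entry is overwritten: two points of the same strip with the same rank
           coincide. *)
        case: ifP => [/and5P[_ _ /eqP kk /eqP ss /eqP rr]|hne].
          subst k'; symmetry; apply/eqP; rewrite eqn_leq (leqNgt i') (leqNgt j).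
          have s1 : p j %/ 2 ^ k * 2 ^ k <= p j < (p j %/ 2 ^ k).+1 * 2 ^ k.
            by rewrite leq_divM ltn_ceil.
          have s2 := s1; rewrite -ss in s2.
          have s3 : p i' %/ 2 ^ k * 2 ^ k <= p i' < (p i' %/ 2 ^ k).+1 * 2 ^ k.
            by rewrite leq_divM ltn_ceil.
          have s4 := s3; rewrite ss in s4.
          move: rr; rewrite /rank ss => rr.
          by rewrite -(box_rank_lt _ s4) -(box_rank_lt _ s1) rr !ltnn.
        apply: hI2 => //; move: hne; rewrite !eqxx /=.
        case: (ltngtP k' k) hd => [_|_|->] //=; rewrite ltnS leq_eqVlt.
        by case: (i' =P j) => [->|_] //=; rewrite !eqxx.
      + by rewrite /=; lia.
    * by [].
    * by rewrite /=; lia.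
  + move=> m2 [h1 h2]; split=> // i' k' hi' hk' hd; apply: h2 => //.
    by rewrite hi'; lia.
  + exact: leqnn.
- move=> m' [h1 h2]; split=> // i k hi hk; apply: h2 => //.
  by rewrite hk.
- exact: leqnn.
Qed.

(** Each column is filled upwards. The abscissa of the point at a given height is read from the
    value table of the other copy [1 - o], which holds the inverse. *)
Definition corner_init o d :=
  for_loop d (Bin Add (Bin Div En Eparam) (Const 1)) (for_loop d.+1 En
    (Seq (Assign d.+2 (Bin Add (Evalue (1 - o) (Reg d.+1)) (Const 1)))
    (Seq (Assign d.+3 (Bin Mul (Reg d) Eparam))
    (Seq (box_code o d.+4 (Reg d.+2) (Reg d.+3) (Const 0) (Reg d.+1))
    (Store (Eaddr (corner_tag o) (Const 0) (Const 0) (Reg d)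
              (Bin Add (Reg d.+1) (Const 1)))
           (Bin Add (Fetch (Eaddr (corner_tag o) (Const 0) (Const 0) (Reg d)
              (Reg d.+1))) (Reg d.+4))))))).

Definition corner_initT := loopT (n %/ q + 1) (loopT n (boxT K + 400)).

Lemma corner_init_spec m G o p pv : o <= 1 -> (forall i, i < n -> pv i < n) ->
  (forall i, i < n -> pv (p i) = i) -> (forall i, i < n -> p (pv i) = i) ->
  base m -> value_table m (1 - o) pv -> cell_table m o p -> fresh (corner_tag o) m ->
  runs w m G (corner_init o (size G))
    (fun m' => outside [:: corner_tag o] m m' /\ corner_table m' o p) corner_initT.
Proof.
move=> o_le pv_lt pK pvK hb hv hc hf; have nB := nn_le_B.
have nq := leq_div n q.
(* Ordinate up to which column [b'] is correct: all of it if finished, [j] if current, and otherwise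
   0, where the initial memory is already right. *)
pose lim b j b' := if b' < b then n else if b' == b then j else 0.
pose I b j m' := outside [:: corner_tag o] m m' /\
  forall b' y, b' <= n %/ q -> y <= n -> y <= lim b j b' ->
  m' (addr n (corner_tag o) 0 0 b' y) = corner_inv p (b' * q) y.
have Ib b j m' : I b j m' -> base m'.
  by move=> [h _]; apply: outside_base h hb; rewrite /= /corner_tag.
apply: runs_impl; first apply: (runs_for (b := n %/ q + 1) (I := fun b => I b 0)).
- by small.
- by [].
- split; first exact: outside_refl.
  move=> b y hb' hy; rewrite /lim ltn0; case: eqP => _; rewrite leqn0 => /eqP ->;
    by rewrite corner_inv0 hf //; lia.
- by move=> b m' /Ib hb'; den.
- move=> b m' hbb hI; have bq : b * q <= n.
    by apply: leq_trans (leq_divM n q); rewrite leq_mul2r; lia.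
  apply: runs_impl; first apply:
    (runs_for (b := n) (I := fun j => I b j) (T := boxT K + 400)).
  + by small.
  + by [].
  + exact: hI.
  + by move=> j m2 /Ib hb'; den.
  + move=> j m2 hj hI2; have hb2 := Ib _ _ _ hI2; case: hI2 => ho hI2.
    have hv2 : value_table m2 (1 - o) pv.
      by apply: outside_value ho _ hv; rewrite inE /val_tag /corner_tag; lia.
    have hc2 : cell_table m2 o p.
      by apply: outside_cell ho _ hc; rewrite inE /cell_tag /corner_tag; lia.
    have pj := pv_lt _ hj.
    have old : m2 (addr n (corner_tag o) 0 0 b j) = corner_inv p (b * q) j.
      by apply: hI2; rewrite /lim ?ltnn ?eqxx; lia.
    have cB := corner_inv_le p (b * q) j.
    have bB : b * q * (b * q) <= n * n by apply: leq_mul.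
    have xB := box_size p (pv j).+1 (b * q) 0 j.
    apply: runs_impl; first apply: runs_let.
    * apply: (computes_eq (v' := (pv j).+1)).
      - by apply: computes_assign; den; rewrite hv2 //; small.
      - by rewrite hv2 // addn1.
      - exact: leqnn.
    * apply: runs_let; first by apply: computes_assign; den.
      apply: runs_let; first by boxs.
      apply: (runs_store (T := 200) (Q := I b j.+1)).
      + by den.
      + by den; rewrite old; small.
      + split; first by apply: outside_upd => //; lia.
        move=> b' y hb' hy hl; rewrite upd_addr //; try lia.
        case: ifP => [/and5P[_ _ _ /eqP -> /eqP ->]|hne].
          by rewrite old addn1 (corner_inv_recr_y pv_lt pK pvK).
        apply: hI2 => //; move: hl hne; rewrite /lim !eqxx /= addn1.
        case: (ltngtP b' b) => // _ /=; rewrite leq_eqVlt => /orP[/eqP ->|//].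
        by rewrite eqxx.
      + by rewrite /=; lia.
    * by [].
    * by rewrite /=; lia.
  + move=> m2 [h1 h2]; split=> // b' y hb' hy hl; apply: h2 => //; move: hl.
    by rewrite /lim; case: (ltngtP b' b) => hbb'; repeat case: ifP; lia.
  + exact: leqnn.
- move=> m' [h1 h2]; split=> // b y hb' hy; apply: h2 => //.
  by rewrite /lim; case: ifP; lia.
- exact: leqnn.
Qed.

(** For each level and each stored first rank, one sweep over the abscissas serves all strips
    together: a point of rank [r] in its strip extends that strip from second rank [r] to [r.+1]. *)
Definition cross_init o d :=
  for_loop d EK (for_loop d.+1 (Bin Add (Bin Div En Eparam) (Const 1)) (for_loop d.+2 En
    (Seq (pow_code d.+3 (Reg d))
    (Seq (Assign d.+4 (Evalue o (Reg d.+2)))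
    (Seq (Assign d.+5 (Bin Div (Reg d.+4) (Reg d.+3)))
    (Seq (Assign d.+6 (Bin Mul (Reg d.+5) (Reg d.+3)))
    (Seq (Assign d.+7 (Bin Add (Reg d.+6) (Reg d.+3)))
    (Seq (box_code o d.+8 (Const 0) (Reg d.+2) (Reg d.+6) (Reg d.+7))
    (Seq (Assign d.+9 (Bin Mul (Reg d.+1) Eparam))
    (Seq (If (Bin Lt (Reg d.+8) (Reg d.+9)) (Assign d.+9.+1 (Const 0))
       (bind d.+9.+1 (Assign d.+9.+1 (Fetch (Eaddr (sel_tag o) (Const 0) (Reg d)
                                               (Reg d.+5) (Reg d.+9))))
       (bind d.+9.+2 (Assign d.+9.+2 (Bin Add (Reg d.+4) (Const 1)))
         (box_code o d.+9.+3 (Const 0) (Reg d.+9.+1) (Reg d.+9.+2) (Reg d.+7)))))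
    (Store (Eaddr (cross_tag o) (Reg d) (Reg d.+5) (Reg d.+1)
              (Bin Add (Reg d.+8) (Const 1)))
           (Bin Add (Fetch (Eaddr (cross_tag o) (Reg d) (Reg d.+5) (Reg d.+1)
              (Reg d.+8))) (Reg d.+9.+1))))))))))))).

Definition cross_initT :=
  loopT K (loopT (n %/ q + 1) (loopT n (powT K + 2 * boxT K + 800))).

Lemma cross_init_spec m G o p : o <= 1 -> (forall i, i < n -> p i < n) ->
  base m -> value_table m o p -> cell_table m o p -> select_table m o p ->
  fresh (cross_tag o) m ->
  runs w m G (cross_init o (size G))
    (fun m' => outside [:: cross_tag o] m m' /\ cross_table m' o p) cross_initT.
Proof.
move=> o_le p_lt hb hv hc hs hf; have nB := nn_le_B; have Kn := K_le.
have nq := leq_div n q.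
(* Abscissa reached by the sweep for level [k'] and first rank [g' * q]. In each strip the entries
   up to the number of strip points before it are correct. *)
pose lim k g j k' g' := if (k' < k) || (k' == k) && (g' < g) then n
  else if (k' == k) && (g' == g) then j else 0.
pose I k g j m' := outside [:: cross_tag o] m m' /\
  forall k' s g' r, k' < K -> s.+1 * 2 ^ k' <= 2 ^ L -> g' <= n %/ q ->
  r <= box p 0 (lim k g j k' g') (s * 2 ^ k') (s.+1 * 2 ^ k') ->
  m' (addr n (cross_tag o) k' s g' r) =
  rank_cross_inv n p (s * 2 ^ k') (s.+1 * 2 ^ k') (g' * q) r.
have sB k' s : s.+1 * 2 ^ k' <= 2 ^ L -> s < N.
  have : s.+1 <= s.+1 * 2 ^ k' by rewrite leq_pmulr // expn_gt0.
  by lia.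
have Ib k g j m' : I k g j m' -> base m'.
  by move=> [h _]; apply: outside_base h hb; rewrite /= /cross_tag.
apply: runs_impl; first apply: (runs_for (b := K) (I := fun k => I k 0 0)).
- by small.
- by [].
- split; first exact: outside_refl.
  move=> k s g r hk hss hg; have := sB _ _ hss => hsN.
  have -> : lim 0 0 0 k g = 0 by rewrite /lim !ltn0 andbF /=; case: ifP.
  rewrite /box big_geq // leqn0 => /eqP ->.
  by rewrite rank_cross_inv_empty // hf //; lia.
- by move=> k m' /Ib hb'; den.
- move=> k m' hk hI; apply: runs_impl; first apply:
    (runs_for (b := n %/ q + 1) (I := fun g => I k g 0)).
  + by small.
  + by [].
  + exact: hI.
  + by move=> g m2 /Ib hb'; den.
  + move=> g m2 hg hI2; have gq : g * q <= n.
      by apply: leq_trans (leq_divM n q); rewrite leq_mul2r; lia.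
    apply: runs_impl; first apply:
      (runs_for (b := n) (I := fun j => I k g j) (T := powT K + 2 * boxT K + 800)).
    * by small.
    * by [].
    * exact: hI2.
    * by move=> j m3 /Ib hb'; den.
    * move=> j m3 hj hI3; have hb3 := Ib _ _ _ _ hI3; case: hI3 => ho hI3.
      have hv3 : value_table m3 o p.
        by apply: outside_value ho _ hv; rewrite inE /val_tag /cross_tag; lia.
      have hc3 : cell_table m3 o p.
        by apply: outside_cell ho _ hc; rewrite inE /cell_tag /cross_tag; lia.
      have hs3 : select_table m3 o p.
        by apply: outside_select ho p_lt _ hs; rewrite inE /sel_tag /cross_tag; lia.
      have pj := p_lt _ hj; have top := strip_top pj hk.
      have dj : p j %/ 2 ^ k <= p j by apply: leq_div.
      have pk : 0 < 2 ^ k by rewrite expn_gt0.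
      have s1 : p j %/ 2 ^ k * 2 ^ k <= p j < (p j %/ 2 ^ k).+1 * 2 ^ k.
        by rewrite leq_divM ltn_ceil.
      have hiE : (p j %/ 2 ^ k).+1 * 2 ^ k = p j %/ 2 ^ k * 2 ^ k + 2 ^ k.
        by rewrite mulSn addnC.
      set s0 := p j %/ 2 ^ k in dj s1 hiE top.
      set hi := s0.+1 * 2 ^ k in s1 hiE top.
      have r0B : box p 0 j (s0 * 2 ^ k) hi <= j.
        by apply: leq_trans (box_size _ _ _ _ _) _; lia.
      set r0 := box p 0 j (s0 * 2 ^ k) hi in r0B.
      have old : m3 (addr n (cross_tag o) k s0 g r0) =
          rank_cross_inv n p (s0 * 2 ^ k) hi (g * q) r0.
        by apply: hI3; rewrite /lim ?ltnn ?eqxx //=; lia.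
      have oldB := rank_cross_inv_le p n (s0 * 2 ^ k) hi (g * q) r0.
      pose X := m3 (addr n (sel_tag o) 0 k s0 (g * q)).
      (* As long as [r0] is below [g * q] both counts are 0, and a point of rank [g * q] need not
         exist. The shape of the test is that of [computes_if]. *)
      pose inc := if (r0 < g * q : nat) != 0 then 0 else box p 0 X (p j).+1 hi.
      (* The search extends to [j.+1], because for [r0 = g * q] the selected point is [j] itself. *)
      have sel : g * q <= r0 ->
          [/\ X <= j, s0 * 2 ^ k <= p X < hi & box p 0 X (s0 * 2 ^ k) hi = g * q].
        move=> har; have hj' : j.+1 <= n by [].
        have [|? ? ?] := selectP (s := s0) (x := j.+1) (t := g * q) hs3 hk hj'.
          by rewrite -/hi box_recr // s1 addn1 ltnS.
        by split.
      have incE : rank_cross_inv n p (s0 * 2 ^ k) hi (g * q) r0.+1 =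
          rank_cross_inv n p (s0 * 2 ^ k) hi (g * q) r0 + inc.
        rewrite /inc; case: ltnP => har /=.
          by rewrite !rank_cross_inv_empty //; lia.
        have [hX1 hX2 hX3] := sel har.
        exact: rank_cross_inv_recr hj s1 _ har hX2 hX3.
      have incB := rank_cross_inv_le p n (s0 * 2 ^ k) hi (g * q) r0.+1.
      apply: runs_impl; first apply: runs_let.
      - by apply: pow_spec; [den | by [] | lia].
      - apply: runs_let.
          apply: (computes_eq (v' := p j)); first by apply: computes_assign; den.
            by rewrite hv3.
          exact: leqnn.
        apply: runs_let; first by apply: computes_assign; den.
        apply: runs_let; first by apply: computes_assign; den.
        apply: runs_let; first by apply: computes_assign; den.
        rewrite -/s0 -hiE; apply: runs_let; first by boxs.
        rewrite -/r0; apply: runs_let; first by apply: computes_assign; den.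
        apply: runs_let.
          apply: (computes_if (v1 := 0) (v2 := box p 0 X (p j).+1 hi)
            (T := boxT K + 100)).
          + by apply: denotes_lt; den.
          + by move=> _; apply: computes_expr; [den | rewrite /=; lia].
          + move=> har; have [|hX1 hX2 hX3] := sel; first by lia.
            apply: computes_eq; first apply: computes_bind.
            * by apply: computes_assign; den.
            * rewrite -/X; apply: computes_bind; first by apply: computes_assign; den.
              by boxs.
            * by rewrite addn1.
            * by rewrite /=; lia.
        rewrite -/inc; apply: (runs_store (T := 250) (Q := I k g j.+1)).
        + by den.
        + by den; rewrite old; small.
        + split; first by apply: outside_upd => //; lia.
          move=> k' s g' r hk' hss hg' hr; have hsN := sB _ _ hss.
          have hrn : r <= n.
            apply: leq_trans hr _; apply: leq_trans (box_size _ _ _ _ _) _.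
            by rewrite /lim; repeat case: ifP; lia.
          rewrite upd_addr //; try lia.
          case: ifP => [/and5P[_ /eqP -> /eqP -> /eqP -> /eqP ->]|hne].
            by rewrite old addn1 incE.
          apply: hI3 => //; move: hne hr; rewrite eqxx /= /lim.
          case: (ltngtP k' k) => [_|_|->] //=.
          case: (ltngtP g' g) => //= _ hne; rewrite box_recr //.
          (* The point [j] adds one rank in its own strip [s0], and that entry has just been
             written; in the other strips of the level nothing becomes due. *)
          have [ss|ss] := eqVneq s s0.
            rewrite ss -/hi s1 -/r0 addn1 leq_eqVlt => /orP[/eqP rr|//].
            by move: hne; rewrite ss rr addn1 !eqxx.
          suff -> : (s * 2 ^ k <= p j < s.+1 * 2 ^ k) = false by rewrite addn0.
          apply/negP => hss'; case/eqP: ss; apply/eqP.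
          by rewrite /s0 eqn_leq leq_divRL // -[_ %/ _ <= s]ltnS ltn_divLR.
        + by rewrite /=; lia.
      - by [].
      - by rewrite /=; lia.
    * move=> m3 [h1 h2]; split=> // k' s g' r hk' hss hg' hr; apply: h2 => //.
      move: hr; suff -> : lim k g.+1 0 k' g' = lim k g n k' g' by [].
      by rewrite /lim; repeat case: ifP; lia.
    * exact: leqnn.
  + move=> m2 [h1 h2]; split=> // k' s g' r hk' hss hg' hr; apply: h2 => //.
    move: hr; suff -> : lim k.+1 0 0 k' g' = lim k (n %/ q + 1) 0 k' g' by [].
    by rewrite /lim; repeat case: ifP; lia.
  + exact: leqnn.
- move=> m' [h1 h2]; split=> // k s g r hk hss hg hr; apply: h2 => //.
  by rewrite /lim hk.
- exact: leqnn.
Qed.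

Definition table_init o d :=
  Seq (cell_init o d) (Seq (select_init o d) (Seq (cross_init o d) (corner_init o d))).

Definition table_tags o := [:: cell_tag o; sel_tag o; cross_tag o; corner_tag o].

Definition table_initT := cell_initT + (select_initT + (cross_initT + corner_initT)).

Lemma table_init_spec m G o p pv : o <= 1 ->
  (forall i, i < n -> p i < n) -> (forall i, i < n -> pv i < n) ->
  (forall i, i < n -> pv (p i) = i) -> (forall i, i < n -> p (pv i) = i) ->
  base m -> value_table m o p -> value_table m (1 - o) pv ->
  (forall t, t \in table_tags o -> fresh t m) ->
  runs w m G (table_init o (size G))
    (fun m' => outside (table_tags o) m m' /\ tables m' o p) table_initT.
Proof.
move=> o_le p_lt pv_lt pK pvK hb hv hv' hf.
have [f1 f3 f4] : [/\ fresh (cell_tag o) m, fresh (cross_tag o) m & fresh (corner_tag o) m].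
  by split; apply: hf; rewrite !inE eqxx ?orbT.
apply: runs_seq; first exact: (cell_init_spec (p := p)).
move=> m1 [o1 hc1].
have hb1 : base m1 by apply: outside_base o1 hb.
have hv1 : value_table m1 o p.
  by apply: outside_value o1 _ hv; rewrite inE /val_tag /cell_tag; lia.
have hv1' : value_table m1 (1 - o) pv.
  by apply: outside_value o1 _ hv'; rewrite inE /val_tag /cell_tag; lia.
apply: runs_seq; first exact: (select_init_spec (p := p)).
move=> m2 [o2 hs2].
have hb2 : base m2 by apply: outside_base o2 hb1.
have hv2 : value_table m2 o p.
  by apply: outside_value o2 _ hv1; rewrite inE /val_tag /sel_tag; lia.
have hv2' : value_table m2 (1 - o) pv.
  by apply: outside_value o2 _ hv1'; rewrite inE /val_tag /sel_tag; lia.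
have hc2 : cell_table m2 o p.
  by apply: outside_cell o2 _ hc1; rewrite inE /cell_tag /sel_tag; lia.
have o12 := outside_trans o1 o2.
apply: runs_seq.
  apply: (cross_init_spec (p := p)) => //.
  by apply: outside_fresh o12 f3; rewrite !inE /cross_tag /cell_tag /sel_tag; lia.
move=> m3 [o3 ht3].
have hb3 : base m3 by apply: outside_base o3 hb2.
have hv3 : value_table m3 o p.
  by apply: outside_value o3 _ hv2; rewrite inE /val_tag /cross_tag; lia.
have hv3' : value_table m3 (1 - o) pv.
  by apply: outside_value o3 _ hv2'; rewrite inE /val_tag /cross_tag; lia.
have hc3 : cell_table m3 o p.
  by apply: outside_cell o3 _ hc2; rewrite inE /cell_tag /cross_tag; lia.
have hs3 : select_table m3 o p.
  by apply: outside_select o3 p_lt _ hs2; rewrite inE /sel_tag /cross_tag; lia.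
have o123 := outside_trans o12 o3.
apply: runs_impl; first apply: (corner_init_spec (p := p) (pv := pv)) => //.
- apply: outside_fresh o123 f4.
  by rewrite !inE /corner_tag /cross_tag /cell_tag /sel_tag; lia.
- move=> m4 [o4 hk4]; split; first exact: outside_trans o123 o4.
  split=> //.
  + by apply: outside_value o4 _ hv3; rewrite inE /val_tag /corner_tag; lia.
  + by apply: outside_cell o4 _ hc3; rewrite inE /cell_tag /corner_tag; lia.
  + by apply: outside_select o4 p_lt _ hs3; rewrite inE /sel_tag /corner_tag; lia.
  + by apply: outside_cross o4 _ ht3; rewrite inE /cross_tag /corner_tag; lia.
- exact: leqnn.
Qed.

Definition value_init d :=
  for_loop d En
    (Seq (Store (Eaddr (val_tag 0) (Const 0) (Const 0) (Const 0) (Reg d))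
                (Bin Sub (Fetch (Bin Add (Reg d) (Const 1))) (Const 1)))
         (Store (Eaddr (val_tag 1) (Const 0) (Const 0) (Const 0)
                  (Bin Sub (Fetch (Bin Add (Reg d) (Const 1))) (Const 1))) (Reg d))).

Definition value_initT := loopT n 300.

Lemma value_init_spec m G p pv :
  (forall i, i < n -> p i < n) -> (forall i, i < n -> pv i < n) ->
  (forall i, i < n -> pv (p i) = i) -> (forall i, i < n -> p (pv i) = i) ->
  base m -> (forall i, i < n -> m i.+1 = (p i).+1) ->
  runs w m G (value_init (size G))
    (fun m' => [/\ outside [:: val_tag 0; val_tag 1] m m', value_table m' 0 p
                 & value_table m' 1 pv]) value_initT.
Proof.
move=> p_lt pv_lt pK pvK hb hin; have nB := nn_le_B.
pose ts := [:: val_tag 0; val_tag 1].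
have updP m' t a v : t \in ts -> a < N -> outside ts m m' ->
    outside ts m (upd m' (addr n t 0 0 0 a) v).
  move=> ht ha h t' a' b' c' d' ht' *; rewrite upd_addr //; try lia.
  by rewrite h //; case: (t' =P t) ht' => // ->; rewrite ht.
pose I j m' := [/\ outside ts m m',
  forall i, i < j -> m' (addr n (val_tag 0) 0 0 0 i) = p i
  & forall i, i < j -> m' (addr n (val_tag 1) 0 0 0 (p i)) = i].
have inE' m' i : outside ts m m' -> i < n -> m' (i + 1) = (p i).+1.
  move=> h hi; rewrite addn1 -hin //.
  by apply: (h 0 0 0 0 i.+1) => //; lia.
have ob m' : outside ts m m' -> base m'.
  by move=> h; apply: outside_base h hb.
apply: runs_impl; first apply: (runs_for (b := n) (I := I) (T := 300)).
- by small.
- by [].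
- by split.
- by move=> j m' [/ob hb' _ _]; den.
- move=> j m' hj [ho h1 h2]; have hb' := ob _ ho; have E := inE' _ _ ho hj.
  have pj := p_lt _ hj.
  pose m1 := upd m' (addr n (val_tag 0) 0 0 0 j) (p j).
  have ho1 : outside ts m m1 by apply: updP => //; rewrite ?inE //; lia.
  have hb1 := ob _ ho1; have E1 := inE' _ _ ho1 hj.
  apply: runs_impl; first apply: (runs_seq (Q1 := fun m2 => m2 = m1)).
  + apply: (runs_store (a := addr n (val_tag 0) 0 0 0 j) (v := p j) (T := 150)) => //.
      by den.
    by apply: denotes_eq; first den; rewrite E; small.
  + move=> m2 ->.
    apply: (runs_store (a := addr n (val_tag 1) 0 0 0 (p j)) (v := j)
      (Q := I j.+1) (T := 150)) => //.
    * apply: denotes_eq; first den; rewrite E1; small.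
      by rewrite subn1.
    * by den.
    * split; first by apply: updP => //; rewrite ?inE //; lia.
        move=> i hi; rewrite /m1 !upd_addr //=; try lia.
        by case: ifP => [/eqP -> //|/negbT ij]; apply: h1; lia.
      move=> i hi; have pi : p i < n by apply: p_lt; lia.
      rewrite /m1 !upd_addr //=; try lia.
      case: ifP => [/eqP Ep|/negbT nEp].
        by rewrite -(pK _ hj) -Ep pK //; lia.
      apply: h2; case: (ltngtP i j) hi => // [|ij]; first by lia.
      by rewrite ij eqxx in nEp.
  + by [].
  + by [].
- move=> m' [h1 h2 h3]; split=> // i hi.
  by rewrite -{1}(pvK _ hi) h3 // pv_lt.
- exact: leqnn.
Qed.

(** There is no logarithm instruction. A counter is raised while 2 to its power is at most [n], that
    is, while the quotient of [n] by it is nonzero; it stalls at [L]. Running [n] rounds is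
    affordable because [q <= n]. *)
Definition setup_code :=
  Seq (Store (Const 0) (Reg 0))
  (Seq (Store (Eaddr 1 (Const 0) (Const 0) (Const 0) (Const 0)) (Reg 1))
  (Seq (iterate 2 (Reg 0) (Const 0)
          (bind 4 (pow_code 4 (Reg 2))
             (If (Bin Div (Reg 0) (Reg 4)) (Assign 5 (Bin Add (Reg 2) (Const 1)))
                                           (Assign 5 (Reg 2)))))
       (Store (Eaddr 1 (Const 0) (Const 0) (Const 0) (Const 1))
              (Bin Add (Reg 2) (Const 1))))).

Definition setupT := loopT n (powT K + 100) + 300.

Lemma setup_spec m :
  runs w m [:: q; n] setup_code
    (fun m' => m' = upd (upd (upd m 0 n) (addr n 1 0 0 0 0) q) (addr n 1 0 0 0 1) K)
    setupT.
Proof.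
have nB := nn_le_B; have Kn := K_le.
have L_gt0 : 0 < L by case: (L) L_gt => //; rewrite expn0; lia.
have L2 : 2 ^ L.-1 <= n by move: L_le; rewrite -{1}(prednK L_gt0) expnS; lia.
have Ln : L <= n by have := ltn_expl L.-1 (isT : 1 < 2); lia.
apply: runs_impl; first apply: (runs_seq (Q1 := fun m1 => m1 = upd m 0 n)).
- by apply: (runs_store (T := 10) (a := 0) (v := n)) => //; den.
- move=> m1 m1E; have m10 : m1 0 = n by rewrite m1E upd_same.
  apply: (runs_seq (Q1 := fun m2 => m2 = upd m1 (addr n 1 0 0 0 0) q)).
    apply: (runs_store (T := 100) (a := addr n 1 0 0 0 0) (v := q)) => //; last den.
    by apply: denotes_addr => //; try den; lia.
  move=> m2 m2E; have m20 : m2 0 = n.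
    by rewrite m2E upd_other // /addr; lia.
  apply: (runs_let (G := [:: q; n])).
    apply: (computes_iterate (G := [:: q; n]) (b := n) (T := powT K + 100)
              (g := fun i => minn i L)) => //.
    + by den.
    + by small.
    + by rewrite min0n; den.
    + move=> i hi; apply: computes_eq.
        apply: (computes_bind (G := [:: i, minn i L & [:: q; n]])).
          apply: (pow_spec (G := [:: i, minn i L & [:: q; n]]) (k := minn i L)) => //.
            by den.
          by rewrite KE geq_min; lia.
        apply: (computes_if (G := [:: _, i, minn i L & [:: q; n]])
                  (v1 := (minn i L).+1) (v2 := minn i L) (T := 50)).
        - by den.
        - move=> _; apply: (computes_expr (G := [:: _, i, minn i L & [:: q; n]])) => //.
          by have mL := geq_minr i L; apply: denotes_eq; [den | rewrite addn1].
        - by move=> _; apply: (computes_expr (G := [:: _, i, minn i L & [:: q; n]])) => //; den.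
      - have [iL|iL] := ltnP i L.
          rewrite (minn_idPl iL) -lt0n divn_gt0 ?expn_gt0 //.
          suff -> : 2 ^ i <= n by [].
          by apply: leq_trans L2; rewrite leq_pexp2l //; lia.
        by rewrite (minn_idPr (leqW iL)) divn_small.
      - by rewrite /=; lia.
  rewrite (minn_idPr Ln).
  apply: (runs_store (T := 100) (a := addr n 1 0 0 0 1) (v := K)) => //.
  + by apply: denotes_addr => //; try den; lia.
  + by apply: denotes_eq; [den | rewrite KE addn1].
  + by rewrite m2E m1E.
- by [].
- by rewrite /setupT /=; lia.
Qed.

(** Separates the arrays from the input cells: writing an array spares the input, and the array
    cells start at 0. *)
Lemma addr_gt t a b c d : 0 < t -> n < addr n t a b c d.
Proof.
move=> ht; have st u v : u <= u * N + v.
  by apply: leq_trans (leq_addr _ _); rewrite leq_pmulr // addn2.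
do 3!apply: leq_trans (st _ _).
by apply: leq_trans (leq_addr _ _); apply: leq_trans (leq_pmull N ht); lia.
Qed.

Definition init_code :=
  Seq setup_code (Seq (value_init 2) (Seq (table_init 0 2) (table_init 1 2))).

Definition initT := setupT + (value_initT + (table_initT + table_initT)).

Lemma init_spec m p pv :
  (forall i, i < n -> p i < n) -> (forall i, i < n -> pv i < n) ->
  (forall i, i < n -> pv (p i) = i) -> (forall i, i < n -> p (pv i) = i) ->
  (forall i, i < n -> m i.+1 = (p i).+1) -> (forall a, n < a -> m a = 0) ->
  runs w m [:: q; n] init_code
    (fun m' => [/\ base m', tables m' 0 p & tables m' 1 pv]) initT.
Proof.
move=> p_lt pv_lt pK pvK hin h0.
apply: runs_seq; first exact: setup_spec.
move=> m1 m1E.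
have u t a b c d : 2 <= t -> a < N -> b < N -> c < N -> d < N ->
    m1 (addr n t a b c d) = 0.
  move=> ht ha hb hc hd; rewrite m1E !upd_addr //; try lia.
  have -> : (t == 1) = false by lia.
  have := @addr_gt t a b c d; rewrite /= upd_other => [h|]; last first.
    by rewrite -lt0n; apply: leq_ltn_trans (addr_gt _ _ _ _ _); lia.
  by rewrite h0 // h; lia.
have s t : 1 <= t -> forall i, i <= n -> i != addr n t 0 0 0 0 /\ i != addr n t 0 0 0 1.
  by move=> ht i hi; rewrite !ltn_eqF //; apply: leq_ltn_trans hi (addr_gt _ _ _ _ ht).
have hb1 : base m1.
  rewrite m1E; split.
  - by have [? ?] := s 1 isT 0 isT; rewrite upd_other // upd_other // upd_same.
  - by rewrite !upd_addr //; lia.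
  - by rewrite upd_same.
have hin1 i : i < n -> m1 i.+1 = (p i).+1.
  by move=> hi; have [? ?] := s 1 isT _ hi; rewrite m1E upd_other // upd_other // upd_other // hin.
apply: runs_seq; first exact: (value_init_spec (G := [:: q; n]) p_lt pv_lt pK pvK hb1 hin1).
move=> m2 [o2 hv2 hv2'].
have hb2 : base m2 by apply: outside_base o2 hb1.
have f2 t : 4 <= t -> fresh t m2.
  move=> ht; apply: outside_fresh o2 _; first by rewrite !inE /val_tag; lia.
  by move=> *; apply: u => //; lia.
apply: runs_seq.
  apply: (table_init_spec (G := [:: q; n]) (o := 0) (pv := pv) isT p_lt) => // t.
  by rewrite !inE /cell_tag /sel_tag /cross_tag /corner_tag => *; apply: f2; lia.
move=> m3 [o3 ht3].
have hb3 : base m3 by apply: outside_base o3 hb2.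
have [hv3 _ _ _ _] := ht3.
apply: runs_impl; first apply:
  (table_init_spec (G := [:: q; n]) (o := 1) (p := pv) (pv := p) isT) => //.
- by apply: outside_value o3 _ hv2'; rewrite !inE.
- move=> t ht; apply: outside_fresh o3 _.
    by move: ht; rewrite !inE /cell_tag /sel_tag /cross_tag /corner_tag; lia.
  by apply: f2; move: ht; rewrite !inE /cell_tag /sel_tag /cross_tag /corner_tag; lia.
- move=> m4 [o4 ht4]; split=> //; first exact: outside_base o4 hb3.
  case: ht3 => a1 a2 a3 a4 a5; split.
  + by apply: outside_value o4 _ a1.
  + by apply: outside_cell o4 _ a2.
  + by apply: outside_select o4 p_lt _ a3.
  + by apply: outside_cross o4 _ a4.
  + by apply: outside_corner o4 _ a5.
- exact: leqnn.
Qed.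

End Query.

(** * Running times *)

(** A division-free form of soft-O on naturals that composes along loops. For [n > 1] the logarithm
    is positive, so exponents may be raised freely. *)
Definition polylog_times (u f : nat -> nat) :=
  exists C k, forall n, 1 < n -> f n <= C * u n * trunc_log 2 n ^ k.

Local Notation one := (fun _ : nat => 1).

Lemma log_gt0 n : 1 < n -> 0 < trunc_log 2 n.
Proof. by move=> hn; rewrite trunc_log_gt0. Qed.

Lemma polylog_mul u v f g : polylog_times u f -> polylog_times v g ->
  polylog_times (fun n => u n * v n) (fun n => f n * g n).
Proof.
move=> [C [k h]] [C' [k' h']]; exists (C * C'), (k + k') => n hn.
apply: leq_trans (leq_mul (h n hn) (h' n hn)) _; rewrite expnD; lia.
Qed.

Lemma polylog_add u f g : polylog_times u f -> polylog_times u g ->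
  polylog_times u (fun n => f n + g n).
Proof.
move=> [C [k h]] [C' [k' h']]; exists (C + C'), (k + k') => n hn.
have l0 := log_gt0 hn; rewrite 2!mulnDl; apply: leq_add.
  by apply: leq_trans (h n hn) _; rewrite leq_mul2l leq_pexp2l ?orbT // leq_addr.
by apply: leq_trans (h' n hn) _; rewrite leq_mul2l leq_pexp2l ?orbT // leq_addl.
Qed.

Lemma polylog_scale c u f : polylog_times u f -> polylog_times u (fun n => c * f n).
Proof.
move=> [C [k h]]; exists (c * C), k => n hn; rewrite -2!mulnA leq_mul2l mulnA.
by rewrite h ?orbT.
Qed.

Lemma polylog_mono u v f : (forall n, 1 < n -> u n <= v n) ->
  polylog_times u f -> polylog_times v f.
Proof.
move=> huv [C [k h]]; exists C, k => n hn; apply: leq_trans (h n hn) _.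
by rewrite leq_mul2r leq_mul2l huv // !orbT.
Qed.

Lemma polylog_const u c : (forall n, 1 < n -> 0 < u n) ->
  polylog_times u (fun _ => c).
Proof. by move=> hu; exists c, 0 => n hn; rewrite expn0 muln1 leq_pmulr // hu. Qed.

Lemma polylog_self u f : (forall n, 1 < n -> f n <= u n) -> polylog_times u f.
Proof. by move=> h; exists 1, 0 => n hn; rewrite mul1n muln1 h. Qed.

(** The value of [K], since the number [L] of binary digits of [n] is [(trunc_log 2 n).+1]. *)
Definition levels n := (trunc_log 2 n).+2.

Lemma polylog_levels : polylog_times one levels.
Proof. by exists 3, 1 => n hn; have := log_gt0 hn; rewrite /levels expn1; lia. Qed.

Section Closure.
Variables (u : nat -> nat) (u_gt0 : forall n, 1 < n -> 0 < u n).

Lemma polylog_loop v b T : (forall n, 1 < n -> 0 < v n) ->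
  polylog_times v b -> polylog_times u T ->
  polylog_times (fun n => v n * u n) (fun n => loopT (b n) (T n)).
Proof.
move=> hv hb hT; apply: polylog_mul.
  have [C [k h]] := polylog_add hb (polylog_const 1 hv).
  by exists C, k => n hn; rewrite -addn1; apply: h.
by apply: polylog_add hT _; apply: polylog_const.
Qed.

Lemma polylog_loop_levels T : polylog_times u T ->
  polylog_times u (fun n => loopT (levels n) (T n)).
Proof.
move=> hT; have := polylog_loop (v := one) (fun n _ => isT) polylog_levels hT.
by apply: polylog_mono => n _; rewrite mul1n.
Qed.

End Closure.

Lemma polylog_one u f : (forall n, 1 < n -> 0 < u n) -> polylog_times one f ->
  polylog_times u f.
Proof. by move=> hu; apply: polylog_mono. Qed.

Lemma polylog_pow : polylog_times one (fun n => powT (levels n)).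
Proof. by apply: polylog_loop_levels => //; apply: polylog_const. Qed.

Lemma polylog_box : polylog_times one (fun n => boxT (levels n)).
Proof.
have h : polylog_times one (fun n => dominanceT (levels n)).
  apply: polylog_loop_levels => //; apply: polylog_add; last exact: polylog_const.
  apply: polylog_loop_levels => //; do 2!(apply: polylog_add; last exact: polylog_const).
  by apply: polylog_add; exact: polylog_pow.
apply: polylog_add; last exact: polylog_const.
exact: polylog_scale.
Qed.

Section Times.
Variable q : nat -> nat.
Hypothesis hq : forall n, 0 < n -> 0 < q n <= n.

Let q_gt0 n : 1 < n -> 0 < q n.
Proof. by move=> hn; have := hq (ltnW hn); lia. Qed.

Lemma polylog_query : polylog_times q (fun n => queryT (q n) (levels n)).
Proof.
have box := polylog_one q_gt0 polylog_box.
have pow := polylog_one q_gt0 polylog_pow.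
have c k := polylog_const k q_gt0.
have walk : polylog_times q (fun n => sumT (q n) (boxT (levels n) + 400)).
  have := polylog_loop (T := fun n => boxT (levels n) + 400 + 20)
    (fun n _ => isT : 0 < one n) q_gt0 (polylog_self (fun n _ => leqnn (q n))).
  case=> [|C [k h]]; last by exists C, k => n hn; have := h n hn; rewrite muln1.
  by do 2!(apply: polylog_add; last exact: polylog_const); apply: polylog_box.
have corner : polylog_times q (fun n => cornerT (levels n) (q n)).
  exact: polylog_add.
have cross : polylog_times q (fun n => crossT (levels n) (q n)).
  apply: polylog_loop_levels => //; apply: polylog_add => //.
  apply: polylog_add => //; apply: polylog_add; last exact: polylog_scale.
  apply: polylog_add => //; apply: polylog_add => //.
  by apply: polylog_add; exact: polylog_scale.
apply: polylog_add => //; apply: polylog_add => //.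
apply: polylog_add => //; apply: polylog_add; last exact: polylog_scale.
by apply: polylog_add; exact: polylog_scale.
Qed.

(** Iterations for one level of the crossing table: the stored first ranks times the abscissas of
    the sweep. *)
Let work n := (n %/ q n + 1) * n.

Lemma polylog_init : polylog_times work (fun n => initT n (q n) (levels n)).
Proof.
have n_gt0 n : 1 < n -> 0 < n by exact: ltnW.
have work_ge n : 1 < n -> n <= work n by move=> hn; rewrite /work leq_pmull // addn1.
have work_gt0 n : 1 < n -> 0 < work n.
  by move=> hn; apply: leq_trans (work_ge _ hn); apply: ltnW.
have b_gt0 n : 1 < n -> 0 < n %/ q n + 1 by rewrite addn1.
have c k : polylog_times one (fun _ => k) by exact: polylog_const.
have box := polylog_box; have pow := polylog_pow.
have idp : polylog_times id id by exact: polylog_self.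
have linear T : polylog_times one T -> polylog_times id (fun n => loopT n (T n)).
  move=> hT; have := polylog_loop (fun n _ => isT : 0 < one n) n_gt0 idp hT.
  by apply: polylog_mono => n _; rewrite muln1.
have quad T : polylog_times id T ->
    polylog_times work (fun n => loopT (n %/ q n + 1) (T n)).
  by apply: polylog_loop => //; exact: polylog_self.
have lin f : polylog_times id f -> polylog_times work f by apply: polylog_mono.
have tab : polylog_times work (fun n => table_initT n (q n) (levels n)).
  apply: polylog_add.
    apply/lin/linear/polylog_loop_levels => //; apply: polylog_loop_levels => //.
    by apply: polylog_add => //; exact: polylog_scale.
  apply: polylog_add.
    apply/lin/polylog_loop_levels => //; apply: linear.
    by apply: polylog_add => //; apply: polylog_add.
  apply: polylog_add.
    apply: polylog_loop_levels => //; apply/quad/linear.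
    by apply: polylog_add => //; apply: polylog_add => //; exact: polylog_scale.
  by apply/quad/linear; apply: polylog_add.
apply: polylog_add.
  apply: polylog_add; last exact: polylog_const.
  by apply/lin/linear; apply: polylog_add.
apply: polylog_add; first by apply/lin/linear.
exact: polylog_add.
Qed.

Local Open Scope ring_scope.
Import GRing.Theory Num.Theory Order.TTheory.

Lemma softO_query : softO (fun n => queryT (q n) (levels n)) (fun n => (q n)%:R).
Proof.
have [C [k h]] := polylog_query; exists C, k, 2 => n hn.
by rewrite -natrX -!natrM ler_nat; apply: h.
Qed.

(** Multiplying [work n] by [q n] gives at most [(n + q n) * n], hence at most twice the square of
    [n] because [q n <= n]; this is the factor 2 in the constant. *)
Lemma softO_init :
  softO (fun n => initT n (q n) (levels n)) (fun n => n%:R ^+ 2 / (q n)%:R).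
Proof.
have [C [k h]] := polylog_init; exists (2 * C)%N, k, 2 => n hn.
have q0 := q_gt0 hn; have /andP[_ qn] := hq (ltnW hn).
move: (h n hn); move: (initT _ _ _) => F hF.
have -> : (2 * C)%:R * (n%:R ^+ 2 / (q n)%:R) * (trunc_log 2 n)%:R ^+ k =
    (2 * C * n ^ 2 * trunc_log 2 n ^ k)%:R / (q n)%:R :> rat.
  by rewrite !natrM !natrX mulrA mulrAC.
rewrite ler_pdivlMr ?ltr0n // -natrM ler_nat.
apply: leq_trans (_ : C * work n * trunc_log 2 n ^ k * q n <= _)%N.
  by rewrite leq_mul2r hF orbT.
rewrite mulnAC leq_mul2r; apply/orP; right.
have hd : (n %/ q n * q n <= n)%N by apply: leq_divM.
have -> : (2 * C * n ^ 2 = C * ((n + n) * n))%N by rewrite expnS expn1; lia.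
rewrite -mulnA leq_mul2l; apply/orP; right.
have -> : (work n * q n = (n %/ q n * q n + q n) * n)%N by rewrite /work; lia.
by rewrite leq_mul2r leq_add ?orbT.
Qed.

End Times.

(** * Assembly of the data structure *)

Lemma input_mem_perm n (pi : 'S_n) i : i < n -> input_mem pi i.+1 = (perm_fun pi i).+1.
Proof. by move=> hi; rewrite /input_mem /perm_fun insubT. Qed.

Lemma input_mem_out n (pi : 'S_n) a : n < a -> input_mem pi a = 0.
Proof. by case: a => // a ha; rewrite /input_mem insubF //; lia. Qed.

(** With [L = (trunc_log 2 n).+1], the factor 1000 takes 10 bits and the fourth power of [2 * n + 2]
    at most [4 * L + 4]. As [L >= 1], the total [4 * L + 14] is within [20 * L]. *)
Definition rectangle_counter := @DataStructure 20 isT init_code query_code.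

Lemma word_size_large n : 0 < n ->
  1000 * ((2 * n + 2) * (2 * n + 2) * (2 * n + 2) * (2 * n + 2))
    < 2 ^ word_size rectangle_counter n.
Proof.
move=> hn; rewrite /word_size /=; set L := (trunc_log 2 n).+1.
have /andP[_ hL] := trunc_log_bounds (isT : 1 < 2) hn.
have hN : 2 * n + 2 <= 2 ^ L.+1 by rewrite -/L in hL; rewrite expnS; lia.
apply: leq_trans (_ : 2 ^ 10 * (2 ^ L.+1 * 2 ^ L.+1 * 2 ^ L.+1 * 2 ^ L.+1) <= _).
  apply: leq_trans (_ : 1024 * ((2 * n + 2) * (2 * n + 2) * (2 * n + 2) * (2 * n + 2)) <= _).
    by rewrite ltn_pmul2r // !muln_gt0 addn2.
  by rewrite leq_mul2l /= !leq_mul.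
by rewrite -!expnD leq_pexp2l // /L; lia.
Qed.

Theorem theorem4p4 (q : nat -> nat) (hq : forall n : nat, 0 < n -> 0 < q n <= n) :
  exists (D : data_structure) (Tinit Tquery : nat -> nat),
    softO Tinit (fun n => (n%:R ^+ 2 / (q n)%:R)%R) /\
    softO Tquery (fun n => (q n)%:R%R) /\
    forall (n : nat) (pi : 'S_n), 0 < n ->
      (exists (t : nat) (s : state),
         run_init D (q n) pi t s /\ t <= Tinit n) /\
      (forall (m : nat -> nat) (d : direction) (R : rect),
         reachable D (q n) pi m -> rect_sub n R ->
         exists (t : nat) (s : state),
           run_query D n d R m t s /\
           output s = count_pairs d pi R /\ t <= Tquery n).
Proof.
exists rectangle_counter, (fun n => initT n (q n) (levels n)),
  (fun n => queryT (q n) (levels n)).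
split; first exact: softO_init.
split; first exact: softO_query.
move=> n pi n_gt0; have /andP[q_gt0 q_le] := hq n n_gt0.
have /andP[L_le L_gt] := trunc_log_bounds (isT : 1 < 2) n_gt0.
have L_le2 : 2 ^ (trunc_log 2 n).+1 <= 2 * n by rewrite expnS; lia.
have W := word_size_large n_gt0.
have p_lt := perm_fun_lt pi; have pv_lt := perm_fun_lt pi^-1.
have pK := perm_funK pi; have pvK := perm_funK pi^-1.
rewrite invgK in pvK.
have [] := init_spec n_gt0 q_gt0 q_le (erefl (levels n)) L_gt L_le2 (leqnn _) W
  p_lt pv_lt pK pvK (@input_mem_perm n pi) (@input_mem_out n pi)
  (s := State (args [:: n; q n]) (input_mem pi)) erefl.
  by [].
move=> t0 [s0 [run0 t0_le _ [s0_base s0_tab s0_tab']]].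
have query d R : rect_sub n R -> exists t s, [/\ run_query rectangle_counter n d R (mem s0) t s,
    output s = count_pairs d pi R, mem s = mem s0 & t <= queryT (q n) (levels n)].
  move=> hR; rewrite count_pairs_sum //.
  move: hR; rewrite /rect_sub => /and5P[h1 h2 h3 h4 /andP[h5 h6]].
  exact: (query_spec n_gt0 q_gt0 q_le (erefl (levels n)) L_gt L_le2 (leqnn _) W
    s0_base d p_lt pv_lt pK pvK s0_tab s0_tab' h1 h2 h3 h4 h5 h6).
(* By determinism every run of the initialisation ends in [s0], and every query run is the one
   constructed above, which leaves the memory as it was. So there is a single reachable memory. *)
have reach m : reachable rectangle_counter (q n) pi m -> m = mem s0.
  elim=> {m} [t s run|d R m t s _ -> hR run].
    by have [_ ->] := exec_det run run0.
  have [t' [s' [run' _ <- _]]] := query d R hR.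
  by have [_ ->] := exec_det run run'.
split; first by exists t0, s0.
move=> m d R /reach -> hR; have [t [s [h1 h2 _ h3]]] := query d R hR.
by exists t, s.
Qed.
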